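(* Let $p$ be an odd prime and let $F$ be a 2-regular graph of order $p$. If $\lambda \equiv 0 \pmod 4$ (with $\lambda \ge 1$), then there exists a 2-factorisation of $\lambda K_p$ into $F$. Moreover, if $F$ satisfies $\nu_3(F) \le \nu_5(F) + \sum_{i=7}^{p} \nu_i(F)$, where $\nu_m(F)$ denotes the number of $m$-cycles in $F$, then such a 2-factorisation of $\lambda K_p$ into $F$ also exists for $\lambda = 3$ and for every integer $\lambda \ge 6$.
   Context: $\lambda K_n$ denotes the complete multigraph of order $n$ with exactly $\lambda$ distinct edges joining each pair of distinct vertices. A 2-factorisation of a (multi)graph into $F$ is a partition of its edge multiset into spanning subgraphs, each isomorphic to the 2-regular graph $F$. *)

(* Defs.v *)
From mathcomp Require Import all_boot.

Set Implicit Arguments.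
Unset Strict Implicit.
Unset Printing Implicit Defensive.

(* Finite loopless multigraphs: edges are distinguishable objects, so parallel
   edges are distinct elements of [edge] with the same pair of ends. *)
Record mgraph := MGraph {
  vert : finType;
  edge : finType;
  ends : edge -> {set vert};
  card_ends : forall e, #|ends e| == 2
}.

Definition graph_order (G : mgraph) : nat := #|vert G|.

Definition simple_graph (G : mgraph) : Prop := injective (@ends G).

Definition vdegree (G : mgraph) (v : vert G) : nat :=
  #|[set e : edge G | v \in ends e]|.

Definition regular_graph (k : nat) (G : mgraph) : Prop :=
  forall v : vert G, vdegree v = k.

Definition isomorphic (G H : mgraph) : Prop :=
  exists (f : vert G -> vert H) (g : edge G -> edge H),
    [/\ bijective f, bijective g & forall e, ends (g e) = f @: ends e].

Definition spanning_subgraph (G : mgraph) (B : {set edge G}) : mgraph :=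
  @MGraph (vert G) {e : edge G | e \in B}
    (fun e => ends (val e)) (fun e => card_ends (val e)).

Definition complete_mgraph (lam n : nat) : mgraph :=
  @MGraph 'I_n ({e : {set 'I_n} | #|e| == 2} * 'I_lam)%type
    (fun e => val e.1) (fun e => valP e.1).

Definition has_factorisation (G F : mgraph) : Prop :=
  exists P : {set {set edge G}},
    partition P [set: edge G] /\
    forall B, B \in P -> isomorphic (spanning_subgraph B) F.

(* [C] is the edge set of a cycle of length [m] of [G]: the ends of its edges,
   counted with multiplicity, are the cyclically consecutive pairs of some
   sequence of [m] distinct vertices. *)
Definition is_cycle (G : mgraph) (m : nat) (C : {set edge G}) : bool :=
  (1 < m) &&
  [exists c : m.-tuple (vert G),
     uniq c && perm_eq [seq ends e | e in C] [seq [set x; next c x] | x <- c]].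

Definition nu (m : nat) (G : mgraph) : nat :=
  #|[set C : {set edge G} | is_cycle m C]|.

(* Main.v *)
Require Import Defs.
From mathcomp Require Import all_boot all_algebra.
From mathcomp Require Import zify.

Set Implicit Arguments.
Unset Strict Implicit.
Unset Printing Implicit Defensive.

(** Identify the vertices of [K_p] with the field [F_p].  If [d] copies of [F]
    decompose the circulant multigraph with differences [w_1, ..., w_d] (all
    nonzero), then the multiples of these copies by [1, ..., (p - 1)/2] decompose
    [d K_p], since each nonzero element is [u w] or [- u w] for exactly one [u].
    So it suffices to decompose one circulant graph with 3 differences and one with
    4 differences, because 3 and 4 generate 3 and all integers from 6 on.

    The circulant graphs are decomposed along the line: segments carrying one, two
    or a few cycles of every factor are glued one after the other, all of them
    having the same pattern of vertices and edges sticking out at their ends.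
    Long cycles are obtained by repeating a periodic middle part.  With differences
    1, 2, 3 there are segments for one cycle of length at least 4, and for a
    triangle together with a cycle of length 5 or at least 7.  With differences
    1, 2, 3, 4 there are segments for an even number of 4-cycles; one more 4-cycle
    is put together with a cycle of length at least 6, or reached by a trade around
    the origin, which replaces the edges [{-1, 1}], [{2, 4}], [{-4, -2}] by
    [{-4, 4}], [{1, 2}], [{-2, -1}].
    Each new edge is a multiple of an old one and the trade is invariant under
    [x |-> - x], so the multiples of the graph still cover [4 K_p]. *)

(** * Edges of closed walks *)

Definition edge_map (T U : Type) (f : T -> U) (e : T * T) : U * U := (f e.1, f e.2).

Definition cycle_edges (T : Type) (s : seq T) : seq (T * T) :=
  if s is x :: t then pairmap pair x (rcons t x) else [::].

Definition cycles_edges (T : Type) (ss : seq (seq T)) : seq (T * T) :=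
  flatten (map (@cycle_edges T) ss).

Lemma map_pairmap_pair (T U : Type) (f : T -> U) x s :
  map (edge_map f) (pairmap pair x s) = pairmap pair (f x) (map f s).
Proof. by elim: s x => //= y s IHs x; rewrite IHs. Qed.

Lemma map_cycle_edges (T U : Type) (f : T -> U) s :
  map (edge_map f) (cycle_edges s) = cycle_edges (map f s).
Proof. by case: s => //= x s; rewrite map_pairmap_pair map_rcons. Qed.

Lemma map_cycles_edges (T U : Type) (f : T -> U) ss :
  map (edge_map f) (cycles_edges ss) = cycles_edges (map (map f) ss).
Proof.
rewrite /cycles_edges map_flatten -!map_comp; congr flatten.
by apply: eq_map => s; apply: map_cycle_edges.
Qed.

Lemma cycles_edges_cons (T : Type) (s : seq T) ss :
  cycles_edges (s :: ss) = cycle_edges s ++ cycles_edges ss.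
Proof. by []. Qed.

Lemma cycles_edges_cat (T : Type) (ss tt : seq (seq T)) :
  cycles_edges (ss ++ tt) = cycles_edges ss ++ cycles_edges tt.
Proof. by rewrite /cycles_edges map_cat flatten_cat. Qed.

Lemma perm_cycles_edges (T : eqType) (ss tt : seq (seq T)) :
  perm_eq ss tt -> perm_eq (cycles_edges ss) (cycles_edges tt).
Proof. by move=> st; apply/perm_flatten/perm_map. Qed.

Lemma size_cycles_edges (T : Type) (ss : seq (seq T)) :
  size (cycles_edges ss) = size (flatten ss).
Proof.
elim: ss => //= s ss IHss; rewrite [LHS]size_cat size_cat -IHss; congr (_ + _).
by case: s => //= x s; rewrite size_pairmap size_rcons.
Qed.

Lemma cycle_edges_next (T : eqType) (s : seq T) :
  uniq s -> cycle_edges s = [seq (x, next s x) | x <- s].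
Proof.
case: s => // x s us; apply: (@eq_from_nth _ (x, x)).
  by rewrite size_pairmap size_map size_rcons.
rewrite size_pairmap size_rcons => i i_lt.
rewrite (nth_pairmap x) ?size_rcons // (nth_map x) // -rcons_cons nth_rcons i_lt.
rewrite next_nth mem_nth // index_uniq // nth_rcons.
move: i_lt; rewrite ltnS leq_eqVlt => /predU1P[->|i_lt]; last by rewrite i_lt.
by rewrite ltnn eqxx (nth_default _ (leqnn (size s))).
Qed.

(** * Permutations of concatenations *)

Lemma perm_flatten_map_cat (S : Type) (T : eqType) (P : pred S) (f g f' g' : S -> seq T) s :
  (forall x, P x -> perm_eq (f x ++ g x) (f' x ++ g' x)) -> all P s ->
  perm_eq (flatten (map f s) ++ flatten (map g s)) (flatten (map f' s) ++ flatten (map g' s)).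
Proof.
move=> fg sP; apply/permP => a; elim: s sP => //= x s IHs /andP[/fg/permP/(_ a) + /IHs].
by rewrite !count_cat; lia.
Qed.

Lemma perm_telescope (T : eqType) (b c i j u v w : seq T) :
  perm_eq (b ++ u) (i ++ v) -> perm_eq (c ++ v) (j ++ w) ->
  perm_eq ((b ++ c) ++ u) ((i ++ j) ++ w).
Proof.
move=> /permP bi /permP cj; apply/permP => a.
by move: (bi a) (cj a); rewrite !count_cat; lia.
Qed.

Lemma perm_replace (T : eqType) (b b' o n i j u v w : seq T) :
  perm_eq (b' ++ o) (b ++ n) -> perm_eq (b ++ u) (i ++ v) ->
  perm_eq (n ++ v) (o ++ j ++ w) -> perm_eq (b' ++ u) ((i ++ j) ++ w).
Proof.
move=> /permP bb' /permP bi /permP on; apply/permP => a.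
by move: (bb' a) (bi a) (on a); rewrite !count_cat; lia.
Qed.

(** * Blocks and tilings of segments *)

Local Notation shift n := (map (addn n)).
Local Notation shift_edges n := (map (edge_map (addn n))).
Local Notation shift_cycles n := (map (map (addn n))).

Lemma shift0 s : shift 0 s = s.
Proof. exact: map_id. Qed.

Lemma shiftD m n s : shift m (shift n s) = shift (m + n) s.
Proof. by rewrite -map_comp; apply: eq_map => x /=; rewrite addnA. Qed.

Lemma iota0D m n : iota 0 (m + n) = iota 0 m ++ shift m (iota 0 n).
Proof. by rewrite iotaD -iotaDl addn0. Qed.

Lemma shift_edges0 es : shift_edges 0 es = es.
Proof. by rewrite -[RHS]map_id; apply: eq_map => -[]. Qed.

Lemma shift_edgesD m n es : shift_edges m (shift_edges n es) = shift_edges (m + n) es.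
Proof. by rewrite -map_comp; apply: eq_map => e; rewrite /edge_map /= !addnA. Qed.

Definition undirected (e : nat * nat) : nat * nat := (minn e.1 e.2, maxn e.1 e.2).

Lemma undirected_shift n es :
  map undirected (shift_edges n es) = shift_edges n (map undirected es).
Proof.
rewrite -!map_comp; apply: eq_map => e.
by rewrite /undirected /edge_map /= addn_minr addn_maxr.
Qed.

Definition circulant_edges (D : seq nat) (n : nat) : seq (nat * nat) :=
  [seq (i, i + d) | i <- iota 0 n, d <- D].

Lemma circulant_edgesD D m n :
  circulant_edges D (m + n) = circulant_edges D m ++ shift_edges m (circulant_edges D n).
Proof.
rewrite /circulant_edges iota0D allpairs_cat map_allpairs allpairs_mapl; congr (_ ++ _).
by apply: eq_allpairs => i d; rewrite /edge_map /= addnA.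
Qed.

(* What a block leaves to the next one: beyond its right end, its [k]-th factor
   uses the vertices [nth [::] spilled_verts k], and its factors together use
   the edges [spilled_edges]. *)
Record pattern := Pattern {
  differences : seq nat;
  spilled_verts : seq (seq nat);
  spilled_edges : seq (nat * nat)
}.

(* The edges [removed] of a circulant graph are replaced by the edges [added];
   multiples of edges are taken with respect to the origin [centre]. *)
Record trade := Trade {
  centre : nat;
  removed : seq (nat * nat);
  added : seq (nat * nat)
}.

Definition no_trade : trade := Trade 0 [::] [::].

Definition fills (ms v : seq nat) (f : seq (seq nat)) : bool :=
  perm_eq (map size f) ms
  && perm_eq (flatten f ++ v) (iota 0 (sumn ms) ++ shift (sumn ms) v).

Definition factors_edges (B : seq (seq (seq nat))) : seq (nat * nat) :=
  map undirected (flatten (map (@cycles_edges nat) B)).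

Definition block (X : pattern) (t : trade) (ms : seq nat) (B : seq (seq (seq nat))) : bool :=
  all2 (fills ms) (spilled_verts X) B
  && perm_eq (factors_edges B ++ spilled_edges X ++ removed t)
       (circulant_edges (differences X) (sumn ms)
          ++ shift_edges (sumn ms) (spilled_edges X) ++ added t).

Definition tiles_trade (X : pattern) (t : trade) (ms : seq nat) : Prop :=
  exists B, block X t ms B.

Definition tiles (X : pattern) (ms : seq nat) : Prop := tiles_trade X no_trade ms.

Lemma perm_fills ms ms' v f : perm_eq ms ms' -> fills ms v f = fills ms' v f.
Proof. by move=> msE; rewrite /fills -(perm_sumn msE) (permPr msE). Qed.

Lemma tiles_trade_perm X t ms ms' :
  perm_eq ms ms' -> tiles_trade X t ms -> tiles_trade X t ms'.
Proof.
move=> msE [B blockB]; exists B; move: blockB; rewrite /block -(perm_sumn msE) !all2E.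
by rewrite (eq_all (a2 := [pred vf | fills ms' vf.1 vf.2])) // => vf; apply: perm_fills.
Qed.

Lemma tiles_nil X : tiles X [::].
Proof.
exists (map (fun _ => [::]) (spilled_verts X)); apply/andP; split.
  elim: (spilled_verts X) => //= v vs ->.
  by rewrite /fills /= shift0 perm_refl.
have -> : factors_edges (map (fun _ => [::]) (spilled_verts X)) = [::].
  by rewrite /factors_edges -map_comp; elim: (spilled_verts X).
by rewrite /= shift_edges0.
Qed.

Definition glue (n : nat) (B C : seq (seq (seq nat))) : seq (seq (seq nat)) :=
  [seq fg.1 ++ shift_cycles n fg.2 | fg <- zip B C].

Lemma fills_cat ms ms' v f g :
  fills ms v f -> fills ms' v g -> fills (ms ++ ms') v (f ++ shift_cycles (sumn ms) g).
Proof.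
move=> /andP[szf vf] /andP[szg vg]; apply/andP; split.
  rewrite map_cat perm_cat // -map_comp.
  by rewrite (eq_map (g := size)) // => s; rewrite /= size_map.
rewrite flatten_cat -map_flatten sumn_cat iota0D -shiftD.
by apply: perm_telescope vf _; rewrite -!map_cat perm_map.
Qed.

Lemma fills_glue ms ms' vs B C :
  all2 (fills ms) vs B -> all2 (fills ms') vs C ->
  all2 (fills (ms ++ ms')) vs (glue (sumn ms) B C).
Proof.
elim: vs B C => [|v vs IHvs] [|f B] [|g C] //= /andP[fvf fvB] /andP[fvg fvC].
by rewrite fills_cat // IHvs.
Qed.

Lemma factors_edges_glue n B C :
  size B = size C ->
  perm_eq (factors_edges (glue n B C)) (factors_edges B ++ shift_edges n (factors_edges C)).
Proof.
rewrite /factors_edges /glue -undirected_shift -map_cat => szBC; apply: perm_map.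
elim: B C szBC => [|f B IHB] [|g C] //= [/IHB/permP IH].
apply/permP => a; move: (IH a).
by rewrite map_cat !count_cat cycles_edges_cat count_cat map_cycles_edges; lia.
Qed.

Lemma tiles_trade_cat X t ms ms' :
  tiles_trade X t ms -> tiles X ms' -> tiles_trade X t (ms ++ ms').
Proof.
move=> [B /andP[fB eB]] [C /andP[fC eC]].
exists (glue (sumn ms) B C); rewrite /block fills_glue //=.
have szBC : size B = size C.
  by move: fB fC; rewrite !all2E => /andP[/eqP<- _] /andP[/eqP<- _].
move: eC; rewrite /= !cats0 => /(perm_map (edge_map (addn (sumn ms)))).
rewrite !map_cat shift_edgesD => eC.
rewrite (perm_catr _ (factors_edges_glue _ szBC)) sumn_cat circulant_edgesD.
by apply: perm_telescope eB _; rewrite !catA perm_cat2r.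
Qed.

Lemma tiles_flatten X (mss : seq (seq nat)) :
  (forall ms, ms \in mss -> tiles X ms) -> tiles X (flatten mss).
Proof.
elim: mss => [|ms mss IHmss] tms /=; first exact: tiles_nil.
apply: tiles_trade_cat; first by apply: tms; rewrite mem_head.
by apply: IHmss => ms' ms'in; apply: tms; rewrite inE ms'in orbT.
Qed.

Lemma tiles_singletons X ms : (forall m, m \in ms -> tiles X [:: m]) -> tiles X ms.
Proof.
move=> tm; rewrite -[ms]map_id -flatten_map1; apply: tiles_flatten => ms' /mapP[m mms ->].
exact: tm.
Qed.

(** * Families of blocks of unbounded length *)

(* One factor of a family of blocks.  Lengthening the segment by [c] positions
   puts copies of [front] and [back] around the path [core], and shifts the
   cycles [moving] and the path [turn], which closes the long cycle. *)
Record strand := Strand {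
  fixed : seq (seq nat);
  moving : seq (seq nat);
  front : seq nat;
  core : seq nat;
  back : seq nat;
  turn : seq nat
}.

Fixpoint spine (c : nat) (x : strand) (q : nat) : seq nat :=
  if q is q'.+1 then shift (c * q') (front x) ++ spine c x q' ++ shift (c * q') (back x)
  else core x.

Definition strand_cycles (c : nat) (x : strand) (q : nat) : seq (seq nat) :=
  (spine c x q ++ shift (c * q) (turn x)) :: fixed x ++ shift_cycles (c * q) (moving x).

Definition strand_wf (c m : nat) (ms : seq nat) (x : strand) : bool :=
  [&& [&& core x != [::], front x != [::] & back x != [::]],
      head 0 (front x) == c + head 0 (core x),
      last 0 (back x) == c + last 0 (core x),
      size (front x) + size (back x) == c,
      size (core x) + size (turn x) == m
    & map size (fixed x ++ moving x) == ms].

Definition old_verts (x : strand) : seq nat := turn x ++ flatten (moving x).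

Definition new_verts (c : nat) (x : strand) : seq nat :=
  front x ++ back x ++ shift c (old_verts x).

Definition turn_edges (x : strand) : seq (nat * nat) :=
  pairmap pair (last 0 (core x)) (rcons (turn x) (head 0 (core x))).

Definition old_edges (x : strand) : seq (nat * nat) :=
  turn_edges x ++ cycles_edges (moving x).

Definition new_edges (c : nat) (x : strand) : seq (nat * nat) :=
  pairmap pair (head 0 (front x)) (rcons (behead (front x)) (head 0 (core x)))
  ++ pairmap pair (last 0 (core x)) (back x) ++ shift_edges c (old_edges x).

Section Strand.

Variables (c m : nat) (ms : seq nat) (x : strand).
Hypothesis x_wf : strand_wf c m ms x.

Lemma spine_ends q :
  exists h t, [/\ spine c x q = h :: t, h = c * q + head 0 (core x)
                & last h t = c * q + last 0 (core x)].
Proof.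
case/and4P: x_wf => /and3P[core0 front0 back0] /eqP headE /eqP lastE _; case: q => [|q] /=.
  by rewrite muln0; case: (core x) core0 => //= y s _; exists y, s.
case: (front x) front0 headE => //= y s _ ->.
exists (c * q + (c + head 0 (core x))), (shift (c * q) s ++ spine c x q ++ shift (c * q) (back x)).
split=> //; first lia.
rewrite !last_cat; case/lastP: (back x) back0 lastE => // t z _.
by rewrite map_rcons !last_rcons => ->; lia.
Qed.

Lemma size_spine q : size (spine c x q) = size (core x) + c * q.
Proof.
case/and5P: x_wf => _ _ _ /eqP cE _; elim: q => [|q IHq] /=; first by rewrite muln0 addn0.
by rewrite !size_cat !size_map IHq mulnS; lia.
Qed.

Lemma size_strand_cycles q : map size (strand_cycles c x q) = m + c * q :: ms.
Proof.
case/and5P: x_wf => _ _ _ _ /andP[/eqP <- /eqP <-] /=.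
rewrite size_cat size_map size_spine addnAC !map_cat -map_comp; congr (_ :: _ ++ _).
by apply: eq_map => s /=; rewrite size_map.
Qed.

Lemma perm_strand_verts q :
  perm_eq (flatten (strand_cycles c x q.+1) ++ shift (c * q) (old_verts x))
          (flatten (strand_cycles c x q) ++ shift (c * q) (new_verts c x)).
Proof.
apply/permP => a; rewrite /= /old_verts /new_verts !flatten_cat -!map_flatten !map_cat !shiftD.
by rewrite !count_cat mulnSr; lia.
Qed.

Definition spine_edges q := pairmap pair (head 0 (spine c x q)) (behead (spine c x q)).

Lemma cycle_edges_spine q :
  cycle_edges (spine c x q ++ shift (c * q) (turn x)) =
  spine_edges q ++ shift_edges (c * q) (turn_edges x).
Proof.
rewrite /spine_edges /turn_edges; have [h [t [-> hE tE]]] := spine_ends q.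
by rewrite /= -cats1 -catA pairmap_cat tE cats1 map_pairmap_pair map_rcons -hE.
Qed.

Lemma spine_edgesS q :
  spine_edges q.+1 =
  shift_edges (c * q)
      (pairmap pair (head 0 (front x)) (rcons (behead (front x)) (head 0 (core x))))
  ++ spine_edges q ++ shift_edges (c * q) (pairmap pair (last 0 (core x)) (back x)).
Proof.
rewrite /spine_edges /=; have [h [t [-> hE tE]]] := spine_ends q.
case/andP: x_wf => /and3P[_ front0 _] _; case: (front x) front0 => //= y s _.
rewrite !map_pairmap_pair map_rcons -hE -tE -pairmap_cat -cats1.
by rewrite -[h :: t ++ _]cat1s catA pairmap_cat last_cat.
Qed.

Lemma perm_strand_edges q :
  perm_eq (cycles_edges (strand_cycles c x q.+1) ++ shift_edges (c * q) (old_edges x))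
          (cycles_edges (strand_cycles c x q) ++ shift_edges (c * q) (new_edges c x)).
Proof.
apply/permP => a; rewrite !cycles_edges_cons !cycles_edges_cat.
rewrite !cycle_edges_spine spine_edgesS.
rewrite /new_edges /old_edges -!map_cycles_edges !map_cat !shift_edgesD -mulnSr !count_cat.
lia.
Qed.

Lemma sumn_strand_cycles q : sumn (m + c * q :: ms) = c * q + (m + sumn ms).
Proof. by rewrite /= addnAC addnC. Qed.

Lemma fills_strandS v q (n := m + sumn ms) :
  perm_eq (new_verts c x ++ shift n v) (old_verts x ++ shift n (iota 0 c) ++ shift (n + c) v) ->
  fills (m + c * q :: ms) v (strand_cycles c x q) ->
  fills (m + c * q.+1 :: ms) v (strand_cycles c x q.+1).
Proof.
rewrite /fills !size_strand_cycles !sumn_strand_cycles -/n mulnSr -addnA [c + n]addnC.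
move=> newE /andP[_ vq]; rewrite perm_refl addnA iota0D -addnA -2!shiftD.
by apply: perm_replace (perm_strand_verts q) vq _; rewrite -shiftD -!map_cat perm_map.
Qed.

End Strand.

Definition family (X : pattern) (c m : nat) (ms : seq nat) (xs : seq strand) : bool :=
  let n := m + sumn ms in
  [&& all (strand_wf c m ms) xs,
      block X no_trade (m :: ms) [seq strand_cycles c x 0 | x <- xs],
      all2 (fun v x => perm_eq (new_verts c x ++ shift n v)
                               (old_verts x ++ shift n (iota 0 c) ++ shift (n + c) v))
        (spilled_verts X) xs
    & perm_eq (map undirected (flatten (map (new_edges c) xs))
                 ++ shift_edges n (spilled_edges X))
              (map undirected (flatten (map old_edges xs))
                 ++ shift_edges n (circulant_edges (differences X) c)
                 ++ shift_edges (n + c) (spilled_edges X))].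

Lemma perm_factors_edgesS c m ms xs q :
  all (strand_wf c m ms) xs ->
  perm_eq (factors_edges [seq strand_cycles c x q.+1 | x <- xs]
             ++ shift_edges (c * q) (map undirected (flatten (map old_edges xs))))
          (factors_edges [seq strand_cycles c x q | x <- xs]
             ++ shift_edges (c * q) (map undirected (flatten (map (new_edges c) xs)))).
Proof.
rewrite /factors_edges -!undirected_shift -!map_cat => xs_wf; apply: perm_map.
rewrite !map_flatten -!map_comp; apply: perm_flatten_map_cat xs_wf => x x_wf.
exact: perm_strand_edges x_wf q.
Qed.

Lemma block_family X c m ms xs q :
  family X c m ms xs ->
  block X no_trade (m + c * q :: ms) [seq strand_cycles c x q | x <- xs].
Proof.
case/and4P=> xs_wf block0 newvE neweE; elim: q => [|q /andP[fq eq]].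
  by rewrite muln0 addn0.
apply/andP; split.
  elim: xs (spilled_verts X) xs_wf newvE fq {block0 neweE eq} => [|x xs IHxs] [|v vs] //=.
  move=> /andP[x_wf xs_wf] /andP[newv newvs] /andP[fv fvs].
  by rewrite (fills_strandS x_wf newv fv) IHxs.
move: eq; rewrite !cats0 !sumn_strand_cycles mulnSr -addnA [c + _]addnC.
set n := m + sumn ms in neweE * => eq; rewrite addnA circulant_edgesD -addnA -2!shift_edgesD.
apply: perm_replace (perm_factors_edgesS q xs_wf) eq _.
by rewrite -shift_edgesD -!map_cat perm_map.
Qed.

Definition tabulated (c m : nat) (blocks : seq (nat * seq (seq (seq nat))))
    (families : seq (nat * seq strand)) : bool :=
  has (fun t => m == t.1) blocks
  || has (fun t => (t.1 <= m) && (m == t.1 %[mod c])) families.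

Lemma tiles_tabulated X c ms m blocks families :
  all (fun t => block X no_trade (t.1 :: ms) t.2) blocks ->
  all (fun t => family X c t.1 ms t.2) families ->
  tabulated c m blocks families -> tiles X (m :: ms).
Proof.
move=> /(all_nthP (0, [::])) blocksP /(all_nthP (0, [::])) familiesP.
case/orP=> [/(has_nthP (0, [::]))|/(has_nthP (0, [::]))] [i /[dup] i_lt].
  by move=> /blocksP block_i /eqP->; eexists; apply: block_i.
move=> /familiesP family_i /andP[le_m]; rewrite eqn_mod_dvd // => /dvdnP[q qE].
by rewrite -(subnKC le_m) qE mulnC; eexists; apply: block_family family_i.
Qed.

(** * Explicit blocks *)

Definition pattern3 : pattern :=
  Pattern [:: 1; 2; 3] [:: [::]; [:: 0; 1]; [:: 0; 2]] [:: (0, 2)].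

Definition pattern4 : pattern :=
  Pattern [:: 1; 2; 3; 4] [:: [:: 2]; [:: 1]; [:: 0]; [:: 0; 1; 3]] [:: (1, 3)].

Definition single_blocks3 : seq (nat * seq (seq (seq nat))) :=
  [:: (4,
        [:: [:: [:: 0; 1; 2; 3]];
            [:: [:: 2; 4; 3; 5]];
            [:: [:: 1; 3; 6; 4]]]);
      (6,
        [:: [:: [:: 0; 1; 2; 5; 4; 3]];
            [:: [:: 2; 3; 6; 5; 7; 4]];
            [:: [:: 1; 3; 5; 8; 6; 4]]])].

Definition single_families3 : seq (nat * seq strand) :=
  [:: (5,
        [:: Strand [::] [::] [:: 6] [:: 3; 0; 1; 2; 4] [:: 5; 7] [::];
            Strand [::] [::] [:: 6; 4] [:: 3; 2; 5] [:: 8] [:: 4; 6];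
            Strand [::] [::] [:: 6; 5] [:: 3; 1; 4] [:: 7] [:: 7; 5]]);
      (7,
        [:: Strand [::] [::] [:: 6] [:: 3; 0; 1; 2; 4] [:: 5; 7] [:: 5; 6];
            Strand [::] [::] [:: 6; 4] [:: 3; 2; 5] [:: 8] [:: 8; 6; 7; 4];
            Strand [::] [::] [:: 6; 5] [:: 3; 1; 4] [:: 7] [:: 6; 9; 7; 5]]);
      (9,
        [:: Strand [::] [::] [:: 6] [:: 3; 0; 1; 2; 4] [:: 5; 7] [:: 5; 8; 7; 6];
            Strand [::] [::] [:: 6; 4] [:: 3; 2; 5] [:: 8] [:: 6; 9; 8; 10; 7; 4];
            Strand [::] [::] [:: 6; 5] [:: 3; 1; 4] [:: 7] [:: 6; 8; 11; 9; 7; 5]])].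

Lemma tiles3_cycle m : 3 < m -> tiles pattern3 [:: m].
Proof.
move=> m_ok; apply: (@tiles_tabulated _ 3 _ m single_blocks3 single_families3).
- by vm_compute.
- by vm_compute.
- by rewrite /tabulated /=; lia.
Qed.

Definition triangle_blocks3 : seq (nat * seq (seq (seq nat))) :=
  [:: (5,
        [:: [:: [:: 4; 6; 7]; [:: 0; 1; 2; 5; 3]];
            [:: [:: 2; 3; 4]; [:: 5; 7; 9; 6; 8]];
            [:: [:: 7; 8; 10]; [:: 1; 3; 6; 5; 4]]]);
      (7,
        [:: [:: [:: 7; 8; 9]; [:: 0; 1; 2; 4; 5; 6; 3]];
            [:: [:: 2; 3; 5]; [:: 4; 6; 8; 11; 9; 10; 7]];
            [:: [:: 1; 3; 4]; [:: 5; 7; 6; 9; 12; 10; 8]]]);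
      (8,
        [:: [:: [:: 8; 9; 10]; [:: 0; 1; 2; 4; 5; 7; 6; 3]];
            [:: [:: 2; 3; 5]; [:: 4; 6; 8; 11; 10; 12; 9; 7]];
            [:: [:: 1; 3; 4]; [:: 5; 6; 9; 11; 13; 10; 7; 8]]]);
      (9,
        [:: [:: [:: 9; 10; 11]; [:: 0; 1; 2; 4; 5; 8; 7; 6; 3]];
            [:: [:: 2; 3; 5]; [:: 4; 6; 8; 10; 13; 11; 12; 9; 7]];
            [:: [:: 1; 3; 4]; [:: 5; 6; 9; 8; 11; 14; 12; 10; 7]]])].

Definition triangle_families3 : seq (nat * seq strand) :=
  [:: (10,
        [:: Strand [::] [:: [:: 10; 11; 12]] [:: 10; 8] [:: 7; 5; 4; 2; 1; 0; 3; 6; 9]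
              [:: 12] [:: 8];
            Strand [:: [:: 2; 3; 5]] [::] [:: 10] [:: 7; 4; 6; 8]
              [:: 9; 11] [:: 10; 13; 12; 14; 11; 9];
            Strand [:: [:: 1; 3; 4]] [::] [:: 10; 9] [:: 7; 6; 5; 8]
              [:: 11] [:: 11; 13; 15; 12; 9; 10]]);
      (11,
        [:: Strand [::] [:: [:: 11; 12; 13]] [:: 10; 8] [:: 7; 5; 4; 2; 1; 0; 3; 6; 9]
              [:: 12] [:: 10; 8];
            Strand [:: [:: 2; 3; 5]] [::] [:: 10] [:: 7; 4; 6; 8]
              [:: 9; 11] [:: 9; 11; 14; 13; 15; 12; 10];
            Strand [:: [:: 1; 3; 4]] [::] [:: 10; 9] [:: 7; 6; 5; 8]
              [:: 11] [:: 11; 10; 13; 16; 14; 12; 9]]);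
      (12,
        [:: Strand [::] [:: [:: 12; 13; 14]] [:: 10; 8] [:: 7; 5; 4; 2; 1; 0; 3; 6; 9]
              [:: 12] [:: 10; 11; 8];
            Strand [:: [:: 2; 3; 5]] [::] [:: 10] [:: 7; 4; 6; 8]
              [:: 9; 11] [:: 9; 11; 13; 16; 14; 15; 12; 10];
            Strand [:: [:: 1; 3; 4]] [::] [:: 10; 9] [:: 7; 6; 5; 8]
              [:: 11] [:: 10; 13; 15; 17; 14; 11; 12; 9]])].

Lemma tiles3_triangle_cycle m : (m == 5) || (6 < m) -> tiles pattern3 [:: m; 3].
Proof.
move=> m_ok; apply: (@tiles_tabulated _ 3 _ m triangle_blocks3 triangle_families3).
- by vm_compute.
- by vm_compute.
- by rewrite /tabulated /=; lia.
Qed.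

Definition single_blocks4 : seq (nat * seq (seq (seq nat))) :=
  [:: (5,
        [:: [:: [:: 0; 1; 4; 7; 3]];
            [:: [:: 0; 2; 3; 6; 4]];
            [:: [:: 1; 2; 4; 3; 5]];
            [:: [:: 2; 5; 4; 8; 6]]]);
      (6,
        [:: [:: [:: 0; 1; 4; 8; 5; 3]];
            [:: [:: 0; 2; 3; 7; 5; 4]];
            [:: [:: 1; 2; 4; 3; 6; 5]];
            [:: [:: 2; 5; 9; 7; 4; 6]]]);
      (7,
        [:: [:: [:: 0; 1; 4; 5; 9; 6; 3]];
            [:: [:: 0; 2; 3; 5; 8; 6; 4]];
            [:: [:: 1; 2; 4; 3; 7; 6; 5]];
            [:: [:: 2; 5; 7; 4; 8; 10; 6]]])].

Definition single_families4 : seq (nat * seq strand) :=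
  [:: (8,
        [:: Strand [::] [::] [:: 8; 6; 5] [:: 4; 1; 0; 3; 7] [:: 11] [:: 10; 6; 5];
            Strand [::] [::] [:: 9; 7; 8] [:: 5; 3; 4; 0; 2; 6] [:: 10] [:: 7; 9];
            Strand [::] [::] [:: 9] [:: 5; 1; 2; 3; 6] [:: 4; 7; 10] [:: 4; 7; 8];
            Strand [::] [::] [:: 8] [:: 4; 2; 5] [:: 7; 6; 9] [:: 7; 11; 9; 6; 8]]);
      (9,
        [:: Strand [::] [::] [:: 8; 6; 5] [:: 4; 1; 0; 3; 7] [:: 11] [:: 11; 8; 5; 6];
            Strand [::] [::] [:: 9; 7; 8] [:: 5; 3; 4; 0; 2; 6] [:: 10] [:: 8; 10; 7];
            Strand [::] [::] [:: 9] [:: 5; 1; 2; 3; 6] [:: 4; 7; 10] [:: 7; 9; 8; 4];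
            Strand [::] [::] [:: 8] [:: 4; 2; 5] [:: 7; 6; 9] [:: 9; 6; 10; 12; 8; 7]]);
      (10,
        [:: Strand [::] [::] [:: 8; 6; 5] [:: 4; 1; 0; 3; 7] [:: 11] [:: 8; 12; 9; 5; 6];
            Strand [::] [::] [:: 9; 7; 8] [:: 5; 3; 4; 0; 2; 6] [:: 10] [:: 8; 9; 11; 7];
            Strand [::] [::] [:: 9] [:: 5; 1; 2; 3; 6] [:: 4; 7; 10] [:: 7; 9; 10; 8; 4];
            Strand [::] [::] [:: 8] [:: 4; 2; 5] [:: 7; 6; 9] [:: 8; 11; 13; 9; 6; 10; 7]]);
      (11,
        [:: Strand [::] [::] [:: 8; 6; 5] [:: 4; 1; 0; 3; 7] [:: 11] [:: 8; 10; 13; 9; 5; 6];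
            Strand [::] [::] [:: 9; 7; 8] [:: 5; 3; 4; 0; 2; 6] [:: 10] [:: 8; 9; 12; 10; 7];
            Strand [::] [::] [:: 9] [:: 5; 1; 2; 3; 6] [:: 4; 7; 10] [:: 7; 9; 10; 11; 8; 4];
            Strand [::] [::] [:: 8] [:: 4; 2; 5] [:: 7; 6; 9] [:: 8; 12; 14; 10; 6; 9; 11; 7]])].

Lemma tiles4_cycle m : 4 < m -> tiles pattern4 [:: m].
Proof.
move=> m_ok; apply: (@tiles_tabulated _ 4 _ m single_blocks4 single_families4).
- by vm_compute.
- by vm_compute.
- by rewrite /tabulated /=; lia.
Qed.

Definition triangle_blocks4 : seq (nat * seq (seq (seq nat))) :=
  [:: (5,
        [:: [:: [:: 0; 1; 4]; [:: 3; 5; 7; 10; 6]];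
            [:: [:: 0; 2; 3]; [:: 4; 5; 9; 6; 7]];
            [:: [:: 1; 2; 5]; [:: 3; 4; 6; 8; 7]];
            [:: [:: 7; 9; 11]; [:: 2; 4; 8; 5; 6]]]);
      (6,
        [:: [:: [:: 7; 8; 11]; [:: 0; 1; 4; 5; 6; 3]];
            [:: [:: 6; 7; 10]; [:: 0; 2; 3; 5; 8; 4]];
            [:: [:: 6; 8; 9]; [:: 1; 2; 4; 3; 7; 5]];
            [:: [:: 8; 10; 12]; [:: 2; 5; 9; 7; 4; 6]]])].

Definition triangle_families4 : seq (nat * seq strand) :=
  [:: (7,
        [:: Strand [::] [:: [:: 8; 9; 12]] [:: 10; 8; 5] [:: 6; 4; 1; 0; 3; 7] [:: 11] [:: 5];
            Strand [::] [:: [:: 7; 8; 11]] [:: 9; 8; 7] [:: 5; 3; 4; 0; 2; 6] [:: 10] [:: 9];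
            Strand [::] [:: [:: 7; 9; 10]] [:: 10; 7; 9] [:: 6; 3; 2; 1; 5; 4; 8] [:: 12] [::];
            Strand [::] [:: [:: 9; 11; 13]] [:: 9] [:: 5; 2; 4; 7] [:: 6; 8; 11] [:: 6; 10; 8]]);
      (8,
        [:: Strand [::] [:: [:: 9; 10; 13]] [:: 9; 8; 6] [:: 5; 4; 1; 0; 3; 7] [:: 11] [:: 6; 8];
            Strand [::] [:: [:: 8; 9; 12]] [:: 9; 7; 8] [:: 5; 3; 4; 0; 2; 6] [:: 10] [:: 10; 7];
            Strand [::] [:: [:: 8; 10; 11]] [:: 9] [:: 5; 1; 2; 3; 6; 4; 7]
              [:: 10; 8; 11] [:: 9];
            Strand [::] [:: [:: 10; 12; 14]] [:: 9; 6; 7] [:: 5; 2; 4; 8]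
              [:: 12] [:: 7; 11; 9; 6]]);
      (9,
        [:: Strand [::] [:: [:: 10; 11; 14]] [:: 9; 6; 8] [:: 5; 4; 1; 0; 3; 7]
              [:: 11] [:: 6; 8; 9];
            Strand [::] [:: [:: 9; 10; 13]] [:: 9] [:: 5; 3; 6; 2; 0; 4; 7]
              [:: 10; 8; 11] [:: 11; 8];
            Strand [::] [:: [:: 9; 11; 12]] [:: 9; 8; 7] [:: 5; 1; 2; 3; 4; 6]
              [:: 10] [:: 10; 8; 7];
            Strand [::] [:: [:: 11; 13; 15]] [:: 9; 7; 6] [:: 5; 2; 4; 8]
              [:: 12] [:: 12; 10; 7; 9; 6]]);
      (10,
        [:: Strand [::] [:: [:: 11; 12; 15]] [:: 9; 6; 8] [:: 5; 4; 1; 0; 3; 7]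
              [:: 11] [:: 8; 10; 6; 9];
            Strand [::] [:: [:: 10; 11; 14]] [:: 9] [:: 5; 3; 6; 2; 0; 4; 7]
              [:: 10; 8; 11] [:: 9; 12; 8];
            Strand [::] [:: [:: 10; 12; 13]] [:: 9; 8; 7] [:: 5; 1; 2; 3; 4; 6]
              [:: 10] [:: 8; 9; 11; 7];
            Strand [::] [:: [:: 12; 14; 16]] [:: 9; 7; 6] [:: 5; 2; 4; 8]
              [:: 12] [:: 11; 13; 9; 10; 7; 6]])].

Lemma tiles4_triangle_cycle m : 4 < m -> tiles pattern4 [:: m; 3].
Proof.
move=> m_ok; apply: (@tiles_tabulated _ 4 _ m triangle_blocks4 triangle_families4).
- by vm_compute.
- by vm_compute.
- by rewrite /tabulated /=; lia.
Qed.

Definition two_triangles_blocks4 : seq (nat * seq (seq (seq nat))) :=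
  [:: (5,
        [:: [:: [:: 0; 1; 4]; [:: 3; 5; 6]; [:: 7; 8; 9; 13; 10]];
            [:: [:: 0; 2; 3]; [:: 4; 5; 7]; [:: 6; 9; 12; 8; 10]];
            [:: [:: 1; 2; 5]; [:: 9; 10; 11]; [:: 3; 4; 8; 6; 7]];
            [:: [:: 2; 4; 6]; [:: 10; 12; 14]; [:: 5; 8; 11; 7; 9]]]);
      (6,
        [:: [:: [:: 5; 7; 9]; [:: 10; 11; 14]; [:: 0; 1; 4; 8; 6; 3]];
            [:: [:: 7; 8; 11]; [:: 9; 10; 13]; [:: 0; 2; 3; 5; 6; 4]];
            [:: [:: 3; 4; 7]; [:: 9; 11; 12]; [:: 1; 2; 6; 10; 8; 5]];
            [:: [:: 2; 4; 5]; [:: 11; 13; 15]; [:: 6; 7; 10; 12; 8; 9]]]);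
      (7,
        [:: [:: [:: 7; 9; 10]; [:: 11; 12; 15]; [:: 0; 1; 4; 6; 8; 5; 3]];
            [:: [:: 8; 9; 12]; [:: 10; 11; 14]; [:: 0; 2; 3; 7; 6; 5; 4]];
            [:: [:: 7; 8; 11]; [:: 10; 12; 13]; [:: 1; 2; 4; 3; 6; 9; 5]];
            [:: [:: 9; 11; 13]; [:: 12; 14; 16]; [:: 2; 5; 7; 4; 8; 10; 6]]]);
      (8,
        [:: [:: [:: 5; 6; 9]; [:: 12; 13; 16]; [:: 0; 1; 4; 8; 10; 11; 7; 3]];
            [:: [:: 9; 10; 13]; [:: 11; 12; 15]; [:: 0; 2; 3; 5; 8; 7; 6; 4]];
            [:: [:: 8; 9; 12]; [:: 11; 13; 14]; [:: 1; 2; 4; 3; 6; 10; 7; 5]];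
            [:: [:: 10; 12; 14]; [:: 13; 15; 17]; [:: 2; 5; 4; 7; 9; 11; 8; 6]]]);
      (9,
        [:: [:: [:: 9; 11; 12]; [:: 13; 14; 17]; [:: 0; 1; 4; 8; 10; 6; 5; 7; 3]];
            [:: [:: 10; 11; 14]; [:: 12; 13; 16]; [:: 0; 2; 3; 5; 9; 7; 8; 6; 4]];
            [:: [:: 9; 10; 13]; [:: 12; 14; 15]; [:: 1; 2; 4; 3; 6; 7; 11; 8; 5]];
            [:: [:: 11; 13; 15]; [:: 14; 16; 18]; [:: 2; 5; 4; 7; 10; 12; 8; 9; 6]]])].

Definition two_triangles_families4 : seq (nat * seq strand) :=
  [:: (10,
        [:: Strand [:: [:: 0; 1; 4]; [:: 3; 5; 6]] [::] [:: 15; 12; 13] [:: 11; 7; 8; 9; 10; 14]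
              [:: 18] [:: 18; 15; 12; 13];
            Strand [:: [:: 0; 2; 3]; [:: 4; 5; 8]] [::] [:: 15; 14; 12] [:: 11; 9; 6; 7; 10; 13]
              [:: 17] [:: 15; 17; 14; 12];
            Strand [:: [:: 1; 2; 5]; [:: 3; 4; 7]] [::] [:: 15] [:: 11; 8; 6; 10; 12; 9; 13]
              [:: 16; 14; 17] [:: 14; 16; 15];
            Strand [:: [:: 2; 4; 6]; [:: 5; 7; 9]] [::] [:: 15; 13; 14] [:: 11; 10; 8; 12]
              [:: 16] [:: 16; 13; 17; 19; 15; 14]]);
      (11,
        [:: Strand [:: [:: 0; 1; 4]; [:: 3; 5; 6]] [::] [:: 15; 12; 13] [:: 11; 7; 8; 9; 10; 14]
              [:: 18] [:: 15; 19; 16; 12; 13];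
            Strand [:: [:: 0; 2; 3]; [:: 4; 5; 8]] [::] [:: 15; 14; 12] [:: 11; 9; 6; 7; 10; 13]
              [:: 17] [:: 15; 16; 18; 14; 12];
            Strand [:: [:: 1; 2; 5]; [:: 3; 4; 7]] [::] [:: 15] [:: 11; 8; 6; 10; 12; 9; 13]
              [:: 16; 14; 17] [:: 14; 16; 17; 15];
            Strand [:: [:: 2; 4; 6]; [:: 5; 7; 9]] [::] [:: 15; 13; 14] [:: 11; 10; 8; 12]
              [:: 16] [:: 15; 18; 20; 16; 13; 17; 14]]);
      (12,
        [:: Strand [:: [:: 0; 1; 4]; [:: 3; 5; 6]] [::] [:: 15; 12; 13] [:: 11; 7; 8; 9; 10; 14]
              [:: 18] [:: 15; 17; 20; 16; 12; 13];
            Strand [:: [:: 0; 2; 3]; [:: 4; 5; 8]] [::] [:: 15; 14; 12] [:: 11; 9; 6; 7; 10; 13]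
              [:: 17] [:: 15; 16; 19; 17; 14; 12];
            Strand [:: [:: 1; 2; 5]; [:: 3; 4; 7]] [::] [:: 15] [:: 11; 8; 6; 10; 12; 9; 13]
              [:: 16; 14; 17] [:: 14; 16; 17; 18; 15];
            Strand [:: [:: 2; 4; 6]; [:: 5; 7; 9]] [::] [:: 15; 13; 14] [:: 11; 10; 8; 12]
              [:: 16] [:: 15; 19; 21; 17; 13; 16; 18; 14]]);
      (13,
        [:: Strand [:: [:: 0; 1; 4]; [:: 3; 5; 6]] [::] [:: 15; 12; 13] [:: 11; 7; 8; 9; 10; 14]
              [:: 18] [:: 15; 17; 21; 18; 16; 12; 13];
            Strand [:: [:: 0; 2; 3]; [:: 4; 5; 8]] [::] [:: 15; 14; 12] [:: 11; 9; 6; 7; 10; 13]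
              [:: 17] [:: 15; 16; 17; 20; 18; 14; 12];
            Strand [:: [:: 1; 2; 5]; [:: 3; 4; 7]] [::] [:: 15] [:: 11; 8; 6; 10; 12; 9; 13]
              [:: 16; 14; 17] [:: 14; 16; 19; 17; 18; 15];
            Strand [:: [:: 2; 4; 6]; [:: 5; 7; 9]] [::] [:: 15; 13; 14] [:: 11; 10; 8; 12]
              [:: 16] [:: 15; 19; 18; 22; 20; 16; 13; 17; 14]])].

Lemma tiles4_two_triangles_cycle m : 4 < m -> tiles pattern4 [:: m; 3; 3].
Proof.
move=> m_ok; apply: (@tiles_tabulated _ 4 _ m two_triangles_blocks4 two_triangles_families4).
- by vm_compute.
- by vm_compute.
- by rewrite /tabulated /=; lia.
Qed.

Definition square_blocks4 : seq (nat * seq (seq (seq nat))) :=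
  [:: (6,
        [:: [:: [:: 0; 1; 4; 3]; [:: 5; 6; 7; 9; 12; 8]];
            [:: [:: 6; 8; 11; 9]; [:: 0; 2; 3; 5; 7; 4]];
            [:: [:: 3; 6; 10; 7]; [:: 1; 2; 4; 8; 9; 5]];
            [:: [:: 2; 5; 4; 6]; [:: 7; 8; 10; 9; 13; 11]]])].

Definition square_families4 : seq (nat * seq strand) :=
  [:: (7,
        [:: Strand [::] [:: [:: 7; 9; 13; 10]] [:: 9; 7; 8] [:: 5; 4; 1; 0; 3; 6] [:: 10] [:: 8];
            Strand [::] [:: [:: 6; 9; 12; 10]] [:: 9; 6; 7] [:: 5; 3; 2; 0; 4; 8] [:: 12] [:: 7];
            Strand [::] [:: [:: 8; 9; 10; 11]] [:: 9; 8; 6] [:: 5; 1; 2; 4; 3; 7] [:: 11] [:: 6];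
            Strand [::] [:: [:: 8; 10; 14; 12]] [:: 9] [:: 5; 2; 6; 4; 7]
              [:: 10; 8; 11] [:: 11; 9]]);
      (8,
        [:: Strand [::] [:: [:: 7; 10; 14; 11]] [:: 10; 7; 5] [:: 6; 3; 0; 1; 4; 8]
              [:: 12] [:: 9; 5];
            Strand [::] [:: [:: 8; 10; 13; 11]] [:: 9] [:: 5; 3; 2; 0; 4; 6]
              [:: 7; 8; 10] [:: 9; 7];
            Strand [::] [:: [:: 9; 10; 11; 12]] [:: 9; 6; 8] [:: 5; 1; 2; 4; 3; 7]
              [:: 11] [:: 6; 8];
            Strand [::] [:: [:: 9; 11; 15; 13]] [:: 10] [:: 6; 2; 5; 4; 7]
              [:: 9; 8; 11] [:: 8; 12; 10]]);
      (9,
        [:: Strand [::] [:: [:: 9; 11; 15; 12]] [:: 10] [:: 6; 3; 0; 1; 4; 7]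
              [:: 5; 8; 11] [:: 5; 8; 10];
            Strand [::] [:: [:: 8; 11; 14; 12]] [:: 9] [:: 5; 3; 2; 0; 4; 6]
              [:: 7; 8; 10] [:: 7; 10; 9];
            Strand [::] [:: [:: 10; 11; 12; 13]] [:: 9; 8; 6] [:: 5; 1; 2; 4; 3; 7]
              [:: 11] [:: 9; 8; 6];
            Strand [::] [:: [:: 10; 12; 16; 14]] [:: 10; 7; 9] [:: 6; 2; 5; 4; 8]
              [:: 12] [:: 7; 11; 13; 9]]);
      (10,
        [:: Strand [::] [:: [:: 9; 12; 16; 13]] [:: 10; 7; 5] [:: 6; 3; 0; 1; 4; 8]
              [:: 12] [:: 10; 11; 7; 5];
            Strand [::] [:: [:: 10; 12; 15; 13]] [:: 9] [:: 5; 3; 2; 0; 4; 6]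
              [:: 7; 8; 10] [:: 7; 8; 11; 9];
            Strand [::] [:: [:: 11; 12; 13; 14]] [:: 9; 6; 8] [:: 5; 1; 2; 4; 3; 7]
              [:: 11] [:: 10; 6; 9; 8];
            Strand [::] [:: [:: 11; 13; 17; 15]] [:: 10] [:: 6; 2; 5; 4; 7]
              [:: 9; 8; 11] [:: 9; 10; 14; 12; 8]])].

Lemma tiles4_square_cycle m : 5 < m -> tiles pattern4 [:: m; 4].
Proof.
move=> m_ok; apply: (@tiles_tabulated _ 4 _ m square_blocks4 square_families4).
- by vm_compute.
- by vm_compute.
- by rewrite /tabulated /=; lia.
Qed.

Lemma tiles4_triangles : tiles pattern4 [:: 3; 3; 3].
Proof.
by exists
  [:: [:: [:: 0; 1; 4]; [:: 3; 5; 6]; [:: 7; 8; 11]];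
      [:: [:: 0; 2; 3]; [:: 4; 5; 8]; [:: 6; 7; 10]];
      [:: [:: 1; 2; 5]; [:: 3; 4; 7]; [:: 6; 8; 9]];
      [:: [:: 2; 4; 6]; [:: 5; 7; 9]; [:: 8; 10; 12]]]; vm_compute.
Qed.

Lemma tiles4_squares : tiles pattern4 [:: 4; 4].
Proof.
by exists
  [:: [:: [:: 0; 1; 5; 4]; [:: 3; 6; 10; 7]];
      [:: [:: 0; 2; 5; 3]; [:: 4; 6; 9; 7]];
      [:: [:: 1; 2; 3; 4]; [:: 5; 6; 7; 8]];
      [:: [:: 2; 4; 8; 6]; [:: 5; 7; 11; 9]]]; vm_compute.
Qed.

Lemma tiles4_triangle_squares : tiles pattern4 [:: 3; 4; 4].
Proof.
by exists
  [:: [:: [:: 9; 10; 13]; [:: 0; 1; 4; 3]; [:: 5; 6; 7; 8]];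
      [:: [:: 8; 9; 12]; [:: 0; 2; 5; 4]; [:: 3; 6; 10; 7]];
      [:: [:: 8; 10; 11]; [:: 1; 2; 3; 5]; [:: 4; 6; 9; 7]];
      [:: [:: 10; 12; 14]; [:: 2; 4; 8; 6]; [:: 5; 7; 11; 9]]]; vm_compute.
Qed.

Lemma tiles4_two_triangles_squares : tiles pattern4 [:: 3; 3; 4; 4].
Proof.
by exists
  [:: [:: [:: 5; 6; 8]; [:: 7; 10; 11]; [:: 0; 1; 4; 3]; [:: 9; 12; 16; 13]];
      [:: [:: 3; 6; 7]; [:: 8; 9; 11]; [:: 0; 2; 5; 4]; [:: 10; 12; 15; 13]];
      [:: [:: 4; 7; 8]; [:: 6; 9; 10]; [:: 1; 2; 3; 5]; [:: 11; 12; 13; 14]];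
      [:: [:: 2; 4; 6]; [:: 5; 7; 9]; [:: 8; 10; 14; 12]; [:: 11; 13; 17; 15]]]; vm_compute.
Qed.

(* Relative to the origin 6, [{-1, 1}] is replaced by [{-4, 4}], [{2, 4}] by [{1, 2}],
   and [{-4, -2}] by [{-2, -1}]. *)
Definition central_trade : trade :=
  Trade 6 [:: (5, 7); (8, 10); (2, 4)] [:: (2, 10); (7, 8); (4, 5)].

Lemma tiles4_trade_triangle_square : tiles_trade pattern4 central_trade [:: 3; 4].
Proof.
by exists
  [:: [:: [:: 0; 1; 4]; [:: 3; 5; 9; 6]];
      [:: [:: 0; 2; 3]; [:: 4; 5; 6; 8]];
      [:: [:: 1; 2; 5]; [:: 3; 4; 6; 7]];
      [:: [:: 2; 6; 10]; [:: 4; 5; 8; 7]]]; vm_compute.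
Qed.

Lemma tiles4_trade_two_triangles_square : tiles_trade pattern4 central_trade [:: 3; 3; 4].
Proof.
by exists
  [:: [:: [:: 0; 1; 4]; [:: 8; 9; 12]; [:: 3; 5; 6; 7]];
      [:: [:: 0; 2; 3]; [:: 7; 8; 11]; [:: 4; 5; 9; 6]];
      [:: [:: 1; 2; 5]; [:: 7; 9; 10]; [:: 3; 4; 8; 6]];
      [:: [:: 2; 6; 10]; [:: 9; 11; 13]; [:: 4; 5; 8; 7]]]; vm_compute.
Qed.

Lemma tiles4_trade_three_triangles_square : tiles_trade pattern4 central_trade [:: 3; 3; 3; 4].
Proof.
by exists
  [:: [:: [:: 4; 6; 8]; [:: 7; 9; 10]; [:: 11; 12; 15]; [:: 0; 1; 5; 3]];
      [:: [:: 3; 6; 7]; [:: 8; 9; 12]; [:: 10; 11; 14]; [:: 0; 2; 5; 4]];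
      [:: [:: 5; 6; 9]; [:: 7; 8; 11]; [:: 10; 12; 13]; [:: 1; 2; 3; 4]];
      [:: [:: 2; 6; 10]; [:: 9; 11; 13]; [:: 12; 14; 16]; [:: 4; 5; 8; 7]]]; vm_compute.
Qed.

Lemma tiles4_trade_square_pentagon : tiles_trade pattern4 central_trade [:: 4; 5].
Proof.
by exists
  [:: [:: [:: 0; 1; 5; 3]; [:: 4; 6; 7; 11; 8]];
      [:: [:: 0; 2; 3; 4]; [:: 5; 6; 10; 7; 8]];
      [:: [:: 1; 2; 5; 4]; [:: 3; 6; 9; 8; 7]];
      [:: [:: 4; 5; 9; 7]; [:: 2; 6; 8; 12; 10]]]; vm_compute.
Qed.

(** * Enumerations and bijections *)

Lemma ex_map_perm (T U : eqType) (f : T -> U) s t :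
  perm_eq t (map f s) -> exists2 s', perm_eq s' s & map f s' = t.
Proof.
case: s => [|x0 s] tE; first by exists [::]; rewrite // (perm_nilP tE).
have [js jsE ->] := perm_iotaP (f x0) tE; exists (map (nth x0 (x0 :: s)) js).
  by rewrite -[X in perm_eq _ X](mkseq_nth x0) -(size_map f) perm_map.
rewrite -map_comp; apply/eq_in_map => j; rewrite (perm_mem jsE) mem_iota => /andP[_ j_lt].
by rewrite [RHS](nth_map x0) // -(size_map f).
Qed.

Lemma ex_map_enum (T : eqType) (U : Type) (s : seq T) (t : seq U) :
  uniq s -> (forall x, x \in s) -> size t = size s -> exists h, map h s = t.
Proof.
case: t => [|y0 t] us in_s sz_t.
  move: in_s; rewrite (size0nil (esym sz_t)) => in_s.
  by exists (fun x => False_rect U (notF (in_s x))).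
exists (fun x => nth y0 (y0 :: t) (index x s)).
apply: (@eq_from_nth _ y0) => [|i]; first by rewrite size_map.
case: s us in_s sz_t => // x0 s us in_s sz_t; rewrite size_map => i_lt.
by rewrite (nth_map x0) // index_uniq.
Qed.

Lemma inj_map_enum (T U : eqType) (h : T -> U) s :
  (forall x, x \in s) -> uniq (map h s) -> injective h.
Proof.
move=> in_s us x y hxy; have hE z : nth (h x) (map h s) (index z s) = h z.
  by rewrite (nth_map x) ?index_mem // nth_index.
have /eqP eq_i : index x s == index y s.
  by rewrite -(nth_uniq (h x) _ _ us) ?size_map ?index_mem // !hE hxy.
by rewrite -(nth_index x (in_s x)) eq_i nth_index.
Qed.

Lemma ex_bij_of_perm (A B : finType) (S : eqType) (f : A -> S) (g : B -> S) :
  perm_eq (map f (enum A)) (map g (enum B)) ->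
  exists2 h : A -> B, bijective h & forall a, f a = g (h a).
Proof.
move=> fg; have [s s_perm gs] := ex_map_perm fg.
have in_enum (x : A) : x \in enum A by rewrite mem_enum.
have sz_s : size s = size (enum A) by rewrite -(size_map g) gs size_map.
have [h hE] := ex_map_enum (enum_uniq A) in_enum sz_s; exists h => [|a].
  apply: inj_card_bij; last by rewrite !cardE -sz_s (perm_size s_perm).
  by apply: (inj_map_enum in_enum); rewrite hE (perm_uniq s_perm) enum_uniq.
have /eq_in_map fE : map f (enum A) = map (g \o h) (enum A) by rewrite map_comp hE.
exact: fE.
Qed.

Lemma count_mem_map_enum (A : finType) (S : eqType) (f : A -> S) s :
  count_mem s (map f (enum A)) = #|[set a | f a == s]|.
Proof.
rewrite count_map -size_filter cardE; apply/perm_size/uniq_perm => [||a].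
- exact/filter_uniq/enum_uniq.
- exact: enum_uniq.
- by rewrite mem_filter !mem_enum !inE /= andbT.
Qed.

(** * Decompositions of complete multigraphs *)

Lemma has_factorisation_labelling (G F : mgraph) (J : finType)
    (f : J -> vert F -> vert G) (label : edge G -> J * edge F) :
  (forall j, bijective (f j)) -> bijective label ->
  (forall e, ends e = f (label e).1 @: ends (label e).2) -> has_factorisation G F.
Proof.
move=> f_bij [unlabel labelK unlabelK] endsE; pose colour e := (label e).1.
exists (preim_partition colour [set: edge G]).
split=> [|B /imsetP[e0 _ BE]]; first exact: preim_partitionP.
have inB e : (e \in B) = (colour e == colour e0) by rewrite BE !inE eq_sym.
have [g fK gK] := f_bij (colour e0).
exists g, (fun e => (label (val e)).2); split=> [||e]; first by exists (f (colour e0)).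
  apply: inj_card_bij => [e1 e2 eq12|].
    apply/val_inj/(can_inj labelK); move: (valP e1) (valP e2); rewrite !inB => /eqP c1 /eqP c2.
    by rewrite [LHS]surjective_pairing [RHS]surjective_pairing eq12 -/(colour _) c1 -c2.
  rewrite card_sig -(card_codom (f := fun e => unlabel (colour e0, e))); last first.
    by move=> e e' /(can_inj unlabelK)[].
  apply: subset_leq_card; apply/subsetP => _ /codomP[e ->].
  by rewrite inB /colour unlabelK.
rewrite /= endsE; have := valP e; rewrite inB => /eqP; rewrite /colour => ->.
by rewrite -imset_comp (eq_imset _ fK) imset_id.
Qed.

(* Each map [f j] places a copy of [F] on [W], and the copies together cover
   every pair of points of [W] [lam] times. *)
Definition has_decomposition (F : mgraph) (W : finType) (lam : nat) : Prop :=
  exists (J : finType) (f : J -> vert F -> W),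
    (forall j, injective (f j)) /\
    (forall a b, a != b -> \sum_j #|[set e | f j @: ends e == [set a; b]]| = lam).

Lemma has_decompositionD F W l1 l2 :
  has_decomposition F W l1 -> has_decomposition F W l2 -> has_decomposition F W (l1 + l2).
Proof.
move=> [J1 [f1 [inj1 cov1]]] [J2 [f2 [inj2 cov2]]].
exists (J1 + J2)%type, (fun j => match j with inl j1 => f1 j1 | inr j2 => f2 j2 end).
split=> [[j|j]|a b ab]; [exact: inj1|exact: inj2|].
by rewrite big_sumType /= cov1 // cov2.
Qed.

Lemma has_decompositionM F W n lam :
  has_decomposition F W lam -> has_decomposition F W (n * lam).
Proof.
move=> dec; elim: n => [|n IHn]; last by rewrite mulSn; apply: has_decompositionD.
exists void, (fun j : void => match j with end); split=> [[]|a b _].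
by rewrite big1 // => -[].
Qed.

Lemma has_decomposition_bij F (W W' : finType) (phi : W -> W') lam :
  bijective phi -> has_decomposition F W lam -> has_decomposition F W' lam.
Proof.
move=> [psi phiK psiK] [J [f [injf cov]]].
exists J, (fun j => phi \o f j); split=> [j|a b ab].
  exact: inj_comp (can_inj phiK) (injf j).
rewrite -(cov (psi a) (psi b)) ?(inj_eq (can_inj psiK)) //.
apply: eq_bigr => j _; apply: eq_card => e; rewrite !inE imset_comp.
have -> : [set a; b] = phi @: [set psi a; psi b] by rewrite imsetU !imset_set1 !psiK.
by apply/eqP/eqP => [/(imset_inj (can_inj phiK))|->].
Qed.

Lemma card_ends_complete lam n (s : {set 'I_n}) :
  #|[set e : edge (complete_mgraph lam n) | ends e == s]| = (#|s| == 2) * lam.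
Proof.
have [s2|s2] := boolP (#|s| == 2); last first.
  apply/eqP; rewrite cards_eq0; apply/eqP/setP => e; rewrite !inE.
  by apply: contraNF s2 => /eqP <-; apply: (valP e.1).
rewrite mul1n -[RHS]card_ord -[RHS]cardsT -[RHS]mul1n.
rewrite -(cards1 (Sub s s2 : {e : {set 'I_n} | #|e| == 2})) -cardsX.
by apply: eq_card => -[e i]; rewrite !inE /= andbT -val_eqE.
Qed.

Lemma has_factorisation_of_decomposition F n lam :
  graph_order F = n -> has_decomposition F 'I_n lam ->
  has_factorisation (complete_mgraph lam n) F.
Proof.
move=> ordF [J [f [injf cov]]].
have f_bij j : bijective (f j).
  by apply: inj_card_bij => //; rewrite card_ord -ordF.
suff [label label_bij labelE] : exists2 label : edge (complete_mgraph lam n) -> J * edge F,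
    bijective label & forall e, ends e = f (label e).1 @: ends (label e).2.
  exact: (@has_factorisation_labelling (complete_mgraph lam n) F J f label).
apply: (ex_bij_of_perm (g := fun je : J * edge F => f je.1 @: ends je.2)).
apply/allP => s _; rewrite /= !count_mem_map_enum card_ends_complete; apply/eqP.
have [/cards2P[a [b [ab ->]]]|s2] := boolP (#|s| == 2); last first.
  apply/esym/eqP; rewrite cards_eq0; apply/eqP/setP => je; rewrite !inE.
  by apply: contraNF s2 => /eqP <-; rewrite card_imset ?card_ends.
rewrite mul1n -(cov a b ab) -[RHS]sum1_card.
rewrite (eq_bigr (fun j => \sum_(e in [set e | f j @: ends e == [set a; b]]) 1)).
  by rewrite pair_big_dep; apply: eq_bigl => je; rewrite !inE.
by move=> j _; rewrite sum1_card.
Qed.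

Definition cycle_system (F : mgraph) (cs : seq (seq (vert F))) : Prop :=
  [/\ uniq (flatten cs), forall v, v \in flatten cs
    & perm_eq [seq ends e | e <- enum (edge F)]
              [seq [set q.1; q.2] | q <- cycles_edges cs]].

Definition joins (T : finType) (a b : T) (e : T * T) : bool := [set e.1; e.2] == [set a; b].

Lemma joinsC (T : finType) (a b x y : T) : joins a b (x, y) = joins a b (y, x).
Proof. by rewrite /joins /= setUC. Qed.

Lemma joinsE (T : finType) (a b x y : T) :
  a != b -> joins a b (x, y) = (x == a) && (y == b) || (x == b) && (y == a).
Proof.
move=> ab; apply/eqP/orP => [/= xyE|[]/andP[/eqP-> /eqP->] //]; last by rewrite setUC.
have /set2P xab : x \in [set a; b] by rewrite -xyE set21.
have /set2P yab : y \in [set a; b] by rewrite -xyE set22.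
have axy : a \in [set x; y] by rewrite xyE set21.
have bxy : b \in [set x; y] by rewrite xyE set22.
case: xab yab => xE [] yE; rewrite xE yE !inE !eqxx ?orbb in axy bxy *; try by [left | right].
  by rewrite eq_sym (negPf ab) in bxy.
by rewrite (negPf ab) in axy.
Qed.

Lemma card_edges_image (F : mgraph) (W : finType) (g : vert F -> W) cs a b :
  cycle_system cs ->
  #|[set e | g @: ends e == [set a; b]]| = count (joins a b) (cycles_edges (map (map g) cs)).
Proof.
case=> _ _ /(perm_map (fun s : {set vert F} => g @: s))/permP/(_ (pred1 [set a; b])).
rewrite -count_mem_map_enum -!map_comp => ->; rewrite -map_cycles_edges !count_map.
by apply: eq_count => e; rewrite /joins /= imsetU !imset_set1.
Qed.

Lemma ex_relabelling (F : mgraph) (W : eqType) (cs : seq (seq (vert F))) (ds : seq (seq W)) :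
  uniq (flatten cs) -> (forall v, v \in flatten cs) ->
  perm_eq (map size ds) (map size cs) -> uniq (flatten ds) ->
  exists2 g : vert F -> W, injective g & perm_eq (map (map g) cs) ds.
Proof.
move=> ucs in_cs /ex_map_perm[cs' cs'E szE] uds.
have flE := perm_flatten cs'E.
have in_cs' v : v \in flatten cs' by rewrite (perm_mem flE).
have [||g gE] := @ex_map_enum _ _ (flatten cs') (flatten ds) _ in_cs'.
- by rewrite (perm_uniq flE).
- by rewrite !size_flatten /shape szE.
exists g; first by apply: (inj_map_enum in_cs'); rewrite gE.
rewrite -(permPl (perm_map (map g) cs'E)) (_ : map _ _ = ds) //.
apply: eq_from_flatten_shape; first by rewrite -map_flatten.
by rewrite /shape -szE -map_comp; apply: eq_map => s /=; rewrite size_map.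
Qed.

Lemma has_decomposition_cycles (F : mgraph) (W J : finType) lam
    (cs : seq (seq (vert F))) (ds : J -> seq (seq W)) :
  cycle_system cs ->
  (forall j, perm_eq (map size (ds j)) (map size cs)) -> (forall j, uniq (flatten (ds j))) ->
  (forall a b, a != b -> \sum_j count (joins a b) (cycles_edges (ds j)) = lam) ->
  has_decomposition F W lam.
Proof.
move=> csP szE uds cov; have [ucs in_cs _] := csP.
have [f fP] := fin_all_exists2 (fun j => ex_relabelling ucs in_cs (szE j) (uds j)).
exists J, f; split=> // a b ab; rewrite -(cov a b ab); apply: eq_bigr => j _.
by rewrite (card_edges_image _ _ _ csP); apply/permP/perm_cycles_edges.
Qed.

(** * Multiples of edges over a prime field *)

Section PrimeField.

Import GRing.Theory.
Local Open Scope ring_scope.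

Variable p : nat.
Hypotheses (p_prime : prime p) (p_odd : odd p).

Lemma natr_Fp_eq0 n : (n%:R == 0 :> 'F_p) = (p %| n)%N.
Proof. by rewrite (dvdn_pcharf (pchar_Fp p_prime)). Qed.

Lemma natr_Fp_neq0 n : (0 < n < p)%N -> n%:R != 0 :> 'F_p.
Proof. by case/andP=> n_gt0 n_lt; rewrite natr_Fp_eq0 gtnNdvd. Qed.

Lemma natr_half_neq0 (i : 'I_(p./2)) : i.+1%:R != 0 :> 'F_p.
Proof. by apply: natr_Fp_neq0; have := ltn_ord i; lia. Qed.

Lemma natr_Fp_inj m n : (m < p)%N -> (n < p)%N -> m%:R = n%:R :> 'F_p -> m = n.
Proof.
by move=> m_lt n_lt /(congr1 (@nat_of_ord _)); rewrite !val_Fp_nat // !modn_small.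
Qed.

Lemma sum_Fp (f : 'F_p -> nat) n :
  n = p -> (\sum_(u : 'F_p) f u = \sum_(i < n) f i%:R)%N.
Proof. by rewrite -[p in n = p]Fp_cast // => ->; apply: eq_bigr => u _; rewrite natr_Zp. Qed.

Lemma sum_units_Fp (f : 'F_p -> nat) :
  (\sum_(u : 'F_p | u != 0%R) f u = \sum_(i < p./2) (f i.+1%:R + f (- i.+1%:R)))%N.
Proof.
have pE : (p./2 + p./2).+1 = p by have := odd_double_half p; rewrite p_odd; lia.
have := sum_Fp f pE; rewrite (bigD1 0) //= big_ord_recl => /addnI ->.
rewrite big_split_ord big_split /=; congr (_ + _)%N.
rewrite (reindex_inj rev_ord_inj); apply: eq_bigr => i _; congr f.
apply/eqP; rewrite -subr_eq0 opprK -natrD natr_Fp_eq0 (_ : _ + _ = p)%N // /bump /=.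
by have := ltn_ord i; lia.
Qed.

Lemma sum_joins_translates (a b w : 'F_p) : a != b ->
  (\sum_(y : 'F_p) joins a b (y, y + w)%R = (w == b - a)%R + (w == a - b)%R)%N.
Proof.
move=> ab; have translateE (y c : 'F_p) : (y + w == c) = (w == c - y).
  by rewrite [RHS]eq_sym subr_eq eq_sym addrC.
under eq_bigr => y _ do rewrite joinsE // !translateE.
have ba : b != a by rewrite eq_sym.
rewrite (bigD1 a) // (bigD1 b) //= big1 => [|y /andP[/negPf-> /negPf->] //].
by rewrite !eqxx (negPf ab) (negPf ba) orbF addn0.
Qed.

Definition joining_multiples (a b : 'F_p) (e : 'F_p * 'F_p) : nat :=
  (\sum_(i < p./2) joins a b (edge_map ( *%R i.+1%:R) e))%N.

Lemma joining_multiplesC a b x y : joining_multiples a b (x, y) = joining_multiples a b (y, x).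
Proof. by apply: eq_bigr => i _; rewrite /edge_map joinsC. Qed.

Lemma joining_multiples_units a b e :
  (joining_multiples a b e + joining_multiples a b (edge_map -%R e)
   = \sum_(u : 'F_p | u != 0%R) joins a b (edge_map ( *%R u) e))%N.
Proof.
rewrite sum_units_Fp -big_split; apply: eq_bigr => i _.
by rewrite /edge_map /= !mulrN !mulNr.
Qed.

Lemma joining_multiples_scale a b s e : s != 0 ->
  (joining_multiples a b e + joining_multiples a b (edge_map -%R e)
   = joining_multiples a b (edge_map ( *%R s) e)
     + joining_multiples a b (edge_map -%R (edge_map ( *%R s) e)))%N.
Proof.
move=> s0; rewrite !joining_multiples_units (reindex_inj (mulIf s0)).
apply: eq_big => u; first by rewrite mulf_eq0 negb_or s0 andbT.
by rewrite /edge_map /= !mulrA.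
Qed.

Lemma joining_multiples_antipodal a b s x : s != 0 ->
  joining_multiples a b (- x, x) = joining_multiples a b (- (s * x), s * x).
Proof.
move=> s0; have := joining_multiples_scale a b (- x, x) s0; rewrite /edge_map /= !mulrN !opprK.
by rewrite ![joining_multiples a b (_, - _)]joining_multiplesC !addnn => /double_inj.
Qed.

(* Among the multiples of [{x, x + w}] by [1, ..., (p - 1)/2], exactly one has
   difference [b - a] up to sign. *)
Lemma sum_joining_multiples (a b w : 'F_p) : a != b -> w != 0 ->
  (\sum_(x : 'F_p) joining_multiples a b (x, x + w)%R = 1)%N.
Proof.
move=> ab w0; rewrite exchange_big /=.
transitivity (\sum_(i < p./2) ((i.+1%:R * w == b - a)%R + (- i.+1%:R * w == b - a)%R))%N.
  apply: eq_bigr => i _; rewrite mulNr eqr_oppLR opprB -sum_joins_translates //.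
  rewrite [RHS](reindex_inj (mulfI (natr_half_neq0 i))) /=.
  by apply: eq_bigr => x _; rewrite /edge_map /= mulrDr.
rewrite -(sum_units_Fp (fun u => nat_of_bool (u * w == b - a))).
have unit_w : (b - a) / w != 0 by rewrite mulf_neq0 ?invr_eq0 // subr_eq0 eq_sym.
rewrite (bigD1 ((b - a) / w)) // divfK //= eqxx big1 // => u /andP[_ u_neq].
by rewrite -(inj_eq (mulIf (invr_neq0 w0))) mulfK // (negPf u_neq).
Qed.

(** * From tilings to decompositions *)

Definition place (o n : nat) : 'F_p := n%:R - o%:R.

Definition covering (o : nat) (a b : 'F_p) (es : seq (nat * nat)) : nat :=
  (\sum_(e <- es) joining_multiples a b (edge_map (place o) e))%N.

Definition neutral (t : trade) : Prop :=
  forall a b : 'F_p, a != b ->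
    covering (centre t) a b (removed t) = covering (centre t) a b (added t).

Lemma place_addp o n : place o (p + n) = place o n.
Proof. by rewrite /place natrD (eqP (_ : p%:R == 0)) ?add0r // natr_Fp_eq0. Qed.

Lemma uniq_place_iota o : uniq (map (place o) (iota 0 p)).
Proof.
rewrite map_inj_in_uniq ?iota_uniq // => m n; rewrite !mem_iota => m_lt n_lt /addIr.
exact: natr_Fp_inj.
Qed.

Lemma covering_cat o a b es es' :
  covering o a b (es ++ es') = (covering o a b es + covering o a b es')%N.
Proof. exact: big_cat. Qed.

Lemma covering_perm o a b es es' : perm_eq es es' -> covering o a b es = covering o a b es'.
Proof. exact: perm_big. Qed.

Lemma covering_shift o a b es :
  covering o a b (map (edge_map (addn p)) es) = covering o a b es.
Proof.
rewrite /covering big_map; apply: eq_bigr => e _.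
by rewrite /edge_map /= !place_addp.
Qed.

Lemma covering_undirected o a b es :
  covering o a b (map undirected es) = covering o a b es.
Proof.
rewrite /covering big_map; apply: eq_bigr => -[x y] _; rewrite /undirected /=.
by case: leqP => // _; apply: joining_multiplesC.
Qed.

Lemma covering_circulant o a b (D : seq nat) :
  a != b -> all (fun d => ~~ (p %| d)%N) D -> covering o a b (circulant_edges D p) = size D.
Proof.
move=> ab Dp; rewrite /covering /circulant_edges big_allpairs_dep exchange_big /= -sum1_size.
rewrite !big_seq; apply: eq_bigr => d /(allP Dp) d_p.
have d0 : d%:R != 0 :> 'F_p by rewrite natr_Fp_eq0.
rewrite -(sum_joining_multiples ab d0) (reindex_inj (addIr (- o%:R))).
apply: etrans (esym (sum_Fp _ (erefl p))).
have -> : iota 0 p = index_iota 0 p by rewrite /index_iota subn0.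
by rewrite big_mkord; apply: eq_bigr => i _; rewrite /edge_map /place /= natrD addrAC.
Qed.

Definition copy (o : nat) (B : seq (seq (seq nat))) (j : 'I_(size B) * 'I_(p./2)) :
    seq (seq 'F_p) :=
  map (map (fun n => j.2.+1%:R * place o n)) (nth [::] B j.1).

Lemma sum_joins_copies o a b B :
  (\sum_j count (joins a b) (cycles_edges (copy o (B := B) j))
   = covering o a b (factors_edges B))%N.
Proof.
rewrite covering_undirected /covering big_flatten big_map (big_nth [::]) big_mkord /copy.
rewrite -(pair_bigA _ (fun (k : 'I__) (i : 'I__) => count (joins a b)
  (cycles_edges (map (map (fun n => i.+1%:R * place o n)) (nth [::] B k))))) /=.
apply: eq_bigr => k _; rewrite [RHS]exchange_big; apply: eq_bigr => i _.
by rewrite -map_cycles_edges count_map -sum1_count big_mkcond.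
Qed.

Lemma neutral_no_trade : neutral no_trade.
Proof. by []. Qed.

Lemma placeD o m : place o (o + m) = m%:R.
Proof. by rewrite /place natrD addrC addKr. Qed.

Lemma placeB o m : (m <= o)%N -> place o (o - m) = - m%:R.
Proof. by move=> le_mo; rewrite /place natrB // addrAC subrr add0r. Qed.

Lemma neutral_central_trade : neutral central_trade.
Proof.
have two_neq0 : 2%:R != 0 :> 'F_p by apply: natr_Fp_neq0; rewrite odd_prime_gt2.
have four_neq0 : 4%:R != 0 :> 'F_p by rewrite -[4%N]/(2 * 2)%N natrM mulf_neq0.
move=> a b _; rewrite /covering !big_cons !big_nil !addn0 /edge_map /=.
rewrite (placeB (m := 1)) // (placeB (m := 2)) // (placeB (m := 4)) //.
rewrite (placeD _ 1) (placeD _ 2) (placeD _ 4).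
rewrite (joining_multiples_antipodal _ _ 1%:R four_neq0) mulr1; congr (_ + _)%N.
have := joining_multiples_scale a b (1%:R, 2%:R) two_neq0.
rewrite /edge_map /= mulr1 -natrM -[(2 * 2)%N]/4%N.
by rewrite (joining_multiplesC a b (- 4%:R)) (joining_multiplesC a b (- 2%:R) (-1)).
Qed.

Lemma uniq_fills o ms v f : sumn ms = p -> fills ms v f -> uniq (map (place o) (flatten f)).
Proof.
rewrite /fills => -> /andP[_ /(perm_map (place o))].
rewrite !map_cat -[map _ (map _ v)]map_comp (eq_map (place_addp o)) perm_cat2r.
by move/perm_uniq->; apply: uniq_place_iota.
Qed.

Lemma has_decomposition_tiles F (cs : seq (seq (vert F))) X t :
  cycle_system cs -> sumn (map size cs) = p ->
  all (fun d => ~~ (p %| d)%N) (differences X) -> neutral t ->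
  tiles_trade X t (map size cs) -> has_decomposition F 'F_p (size (differences X)).
Proof.
move=> csP sz_cs Xp t_neutral [B /andP[fB eB]].
have fillsB (k : 'I_(size B)) : exists v, fills (map size cs) v (nth [::] B k).
  move: fB; rewrite all2E => /andP[/eqP szB /(all_nthP ([::], [::])) fB].
  exists (nth [::] (spilled_verts X) k).
  by have := fB k; rewrite size_zip szB minnn nth_zip //; apply.
apply: (has_decomposition_cycles (ds := copy (centre t) (B := B)) csP) => [[k i]|[k i]|a b ab].
- have [v /andP[szB _]] := fillsB k; rewrite -map_comp.
  by rewrite (eq_map (g := size)) // => s; rewrite /= size_map.
- have [v vB] := fillsB k; rewrite -map_flatten (map_comp ( *%R _)) map_inj_uniq.
    exact: uniq_fills sz_cs vB.
  exact/mulfI/natr_half_neq0.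
have := covering_perm (centre t) a b eB; rewrite sz_cs !covering_cat covering_shift.
rewrite (t_neutral a b ab) !addnA => /addIn/addIn; rewrite covering_circulant // => <-.
exact: sum_joins_copies.
Qed.

End PrimeField.

(** * Circuits of 2-regular graphs *)

Lemma next_neq_prev (T : eqType) (c : seq T) x :
  uniq c -> 2 < size c -> x \in c -> next c x != prev c x.
Proof.
move=> uc c3 xc; have [i s cE] := rot_to xc.
have us : uniq (x :: s) by rewrite -cE rot_uniq.
have s2 : 1 < size s by rewrite -(size_rot i) cE in c3.
rewrite -(next_rot i uc) -(prev_rot i uc) cE; case: s us s2 {cE} => [|y [|z s]] // us _.
apply/negP => /eqP/(congr1 (next [:: x, y, z & s])); rewrite next_prev //= eqxx.
move: us; rewrite /= !inE !negb_or => /andP[/and3P[xy xz _] _].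
by rewrite eq_sym (negPf xy) eqxx => zx; rewrite zx eqxx in xz.
Qed.

Lemma uniq_next_pairs (T : finType) (c : seq T) :
  uniq c -> 2 < size c -> uniq [seq [set x; next c x] | x <- c].
Proof.
move=> uc c3; rewrite map_inj_in_uniq // => x y xc yc xyE.
have /set2P[//|xE] : x \in [set y; next c y] by rewrite -xyE set21.
have /set2P[//|yE] : y \in [set x; next c x] by rewrite xyE set21.
by have := next_neq_prev uc c3 xc; rewrite {2}xE prev_next // -yE eqxx.
Qed.

Lemma uniq_flatten_mem_eq (T : eqType) (ss : seq (seq T)) s t x :
  uniq (flatten ss) -> s \in ss -> t \in ss -> x \in s -> x \in t -> s = t.
Proof.
elim: ss => //= r ss IHss; rewrite cat_uniq => /and3P[_ /hasPn rss uss].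
have notin u : u \in ss -> x \in u -> x \notin r.
  by move=> u_ss xu; apply: rss; apply/flattenP; exists u.
rewrite !inE => /orP[/eqP->|s_ss] /orP[/eqP->|t_ss] // xs xt.
- by have := notin t t_ss xt; rewrite xs.
- by have := notin s s_ss xs; rewrite xt.
- exact: IHss.
Qed.

Lemma uniq_flatten_uniq (T : eqType) (ss : seq (seq T)) :
  uniq (flatten ss) -> [::] \notin ss -> uniq ss.
Proof.
elim: ss => //= r ss IHss; rewrite cat_uniq inE negb_or => /and3P[_ /hasPn rss uss].
case: r rss => // x r rss /andP[_ /(IHss uss) ->]; rewrite andbT; apply/negP => r_ss.
have x_ss : x \in flatten ss by apply/flattenP; exists (x :: r); rewrite ?mem_head.
by have := rss x x_ss; rewrite mem_head.
Qed.

Section TwoRegular.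

Variable F : mgraph.
Hypotheses (F_simple : simple_graph F) (F_regular : regular_graph 2 F).

Definition adjacent : rel (vert F) := fun x y => [exists e, ends e == [set x; y]].

Definition neighbours (x : vert F) : {set vert F} := [set y | adjacent x y].

Definition circuit (c : seq (vert F)) : bool := [&& uniq c, 2 < size c & cycle adjacent c].

Lemma circuit_inhabited c : circuit c -> exists x, x \in c.
Proof. by case: c => [|x c _]; [rewrite /circuit | exists x; rewrite mem_head]. Qed.

Lemma adjacentP x y : reflect (exists e, ends e = [set x; y]) (adjacent x y).
Proof. by apply: (iffP existsP) => -[e eE]; exists e; apply/eqP. Qed.

Lemma adjacent_sym : symmetric adjacent.
Proof. by move=> x y; apply/adjacentP/adjacentP => -[e eE]; exists e; rewrite eE setUC. Qed.

Lemma adjacent_irr : irreflexive adjacent.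
Proof.
by move=> x; apply/adjacentP => -[e eE]; have := card_ends e; rewrite eE setUid cards1.
Qed.

Lemma edge_inhabited (e : edge F) : exists x, x \in ends e.
Proof. by apply/card_gt0P; rewrite (eqP (card_ends e)). Qed.

Lemma ends_adjacent e x : x \in ends e -> exists2 y, adjacent x y & ends e = [set x; y].
Proof.
move=> xe; have /cards2P[a [b [_ eE]]] := card_ends e.
suff [y eE'] : exists y, ends e = [set x; y] by exists y => //; apply/adjacentP; exists e.
by move: xe; rewrite eE => /set2P[]->; [exists b | exists a; rewrite setUC].
Qed.

Lemma card_neighbours x : #|neighbours x| = 2.
Proof.
rewrite -(F_regular x) /vdegree -(card_imset _ F_simple).
rewrite -(@card_in_imset _ _ (fun y => [set x; y])) => [|y z]; last first.
  rewrite !inE => xy _ yzE; have /set2P[yx|//] : y \in [set x; z] by rewrite -yzE set22.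
  by rewrite yx adjacent_irr in xy.
congr #|pred_of_set _|; apply/setP => s; apply/imsetP/imsetP => -[].
  by move=> y; rewrite inE => /adjacentP[e eE] ->; exists e => //; rewrite inE eE set21.
by move=> e; rewrite inE => /ends_adjacent[y xy eE] ->; exists y; rewrite ?inE.
Qed.

Lemma handshake : #|edge F| = #|vert F|.
Proof.
have sumE : \sum_(v : vert F) vdegree v = \sum_(e : edge F) #|ends e|.
  under eq_bigr => v _ do rewrite /vdegree -sum1dep_card.
  by rewrite (exchange_big_dep xpredT) //=; apply: eq_bigr => e _; rewrite sum1_card.
move: sumE; under eq_bigr do rewrite F_regular.
under [in RHS]eq_bigr => e _ do rewrite (eqP (card_ends e)).
by rewrite !sum_nat_const => /eqP; rewrite eqn_pmul2r // => /eqP.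
Qed.

Lemma neighbours_circuit c x :
  circuit c -> x \in c -> neighbours x = [set next c x; prev c x].
Proof.
case/and3P=> uc c3 cc xc; apply/esym/eqP.
rewrite eqEcard card_neighbours cards2 next_neq_prev // andbT.
apply/subsetP => y /set2P[]->; rewrite inE; first exact: next_cycle cc xc.
by rewrite adjacent_sym; apply: prev_cycle cc xc.
Qed.

Lemma circuit_closed c x : circuit c -> x \in c -> {subset neighbours x <= c}.
Proof.
by move=> cP xc y; rewrite (neighbours_circuit cP xc) => /set2P[]->; rewrite ?mem_next ?mem_prev.
Qed.

Lemma circuit_sub_closed (A : {pred vert F}) c x :
  (forall y, y \in A -> {subset neighbours y <= A}) ->
  circuit c -> x \in c -> x \in A -> {subset c <= A}.
Proof.
move=> clA /and3P[_ _ cc] xc xA y; have [i s cE] := rot_to xc.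
rewrite -(mem_rot i) cE; move: cc; rewrite -(rot_cycle i) cE /= rcons_path => /andP[ps _].
elim: s x xA ps {xc cE} => [|z s IHs] x xA /=; first by rewrite inE => _ /eqP->.
case/andP=> xz ps; rewrite inE => /predU1P[->//|].
by apply: IHs ps; apply: clA xA _ _; rewrite inE.
Qed.

Lemma eq_mem_circuit c d x : circuit c -> circuit d -> x \in c -> x \in d -> c =i d.
Proof.
have sub (a b : seq (vert F)) :
    circuit a -> circuit b -> x \in a -> x \in b -> {subset a <= b}.
  by move=> aP bP xa xb; apply: circuit_sub_closed aP xa xb => y; apply: circuit_closed.
by move=> cP dP xc xd y; apply/idP/idP; apply: sub.
Qed.

Lemma adjacent_in_path x t z :
  uniq (x :: t) -> path adjacent x t -> z \in t -> adjacent x z -> z = head x t \/ z = last x t.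
Proof.
move=> + + zt xz; case/splitPr: zt => t1 t2.
case/lastP: t1 => [|t1 a]; first by left.
case: t2 => [|b t2]; first by right; rewrite last_cat.
rewrite cat_path last_rcons /= => ut /and4P[_ az zb _].
have sub_xab : subseq [:: x; a; b] (x :: rcons t1 a ++ [:: z, b & t2]).
  rewrite /= eqxx -[[:: a; b]]/([:: a] ++ [:: b]) cat_subseq ?sub1seq //.
    by rewrite mem_rcons mem_head.
  by rewrite !inE eqxx orbT.
have : [set y in [:: x; a; b]] \subset neighbours z.
  by apply/subsetP => y; rewrite !inE => /or3P[]/eqP->; rewrite // adjacent_sym.
move/subset_leq_card; rewrite card_neighbours cardsE.
by rewrite (card_uniqP (subseq_uniq sub_xab ut)).
Qed.

Lemma circuit_of_path x t :
  uniq (x :: t) -> path adjacent x t -> {subset neighbours x <= t} -> circuit (x :: t).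
Proof.
move=> ut pt sub_t; have /cards2P[y [z [yz xE]]] : #|neighbours x| == 2.
  by rewrite card_neighbours.
have ends_t u : u \in neighbours x -> u = head x t \/ u = last x t.
  by move=> xu; apply: adjacent_in_path (sub_t u xu) _ => //; rewrite inE in xu.
have lastN : last x t \in neighbours x /\ head x t != last x t.
  have yN : y \in neighbours x by rewrite xE set21.
  have zN : z \in neighbours x by rewrite xE set22.
  have [yE|yE] := ends_t y yN; have [zE|zE] := ends_t z zN; rewrite -yE -?zE.
  - by rewrite yE zE eqxx in yz.
  - by [].
  - by rewrite eq_sym.
  - by rewrite yE zE eqxx in yz.
rewrite /circuit ut /= rcons_path pt adjacent_sym; case: lastN => + ht; rewrite inE => ->.
by case: t ht {ut pt sub_t ends_t} => [|a [|b t]] //=; rewrite eqxx.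
Qed.

Lemma ex_maximal_path (W : {set vert F}) x0 :
  x0 \in W -> (forall x, x \in W -> {subset neighbours x <= W}) ->
  exists x t, [/\ uniq (x :: t), path adjacent x t, {subset x :: t <= W}
                & {subset neighbours x <= t}].
Proof.
move=> x0W clW; pose good n := [exists t : n.-tuple (vert F),
  [&& 0 < n, uniq t, sorted adjacent t & all (fun y => y \in W) t]].
have ex_good : exists n, good n.
  by exists 1; apply/existsP; exists [tuple x0]; rewrite /= x0W.
have bound_good n : good n -> n <= #|vert F|.
  case/existsP => t /and4P[_ ut _ _].
  by rewrite -(size_tuple t) -(card_uniqP ut) max_card.
case: (ex_maxnP ex_good bound_good) => n /existsP[[[|x t] sz_t]] /and4P[n_gt0 ut pt tW] maxn.
  by rewrite -(eqP sz_t) in n_gt0.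
exists x, t; split=> // [|y]; first exact/allP.
rewrite inE => xy; apply/negPn/negP => yt; suff: good n.+1 by move/maxn; rewrite ltnn.
have sz_yt : size [:: y, x & t] == n.+1 by rewrite -(eqP sz_t).
apply/existsP; exists (Tuple sz_yt); move: ut pt tW => /= ut pt /andP[xW tW].
rewrite inE negb_or yt adjacent_sym xy ut pt xW tW (clW x) ?inE // !andbT.
by apply: contraTneq xy => ->; rewrite adjacent_irr.
Qed.

Lemma ex_circuits (W : {set vert F}) :
  (forall x, x \in W -> {subset neighbours x <= W}) ->
  exists cs, [/\ uniq (flatten cs), flatten cs =i W & all circuit cs].
Proof.
have [n] := ubnP #|W|; elim: n W => // n IHn W ltWn clW.
have [->|[x0 x0W]] := set_0Vmem W; first by exists [::]; split=> // x; rewrite inE.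
have [c cP cW] : exists2 c, circuit c & {subset c <= W}.
  have [x [t [ut pt tW xt]]] := ex_maximal_path x0W clW.
  by exists (x :: t) => //; apply: circuit_of_path.
pose W' := W :\: [set y in c].
have [||cs [ucs csW csP]] := IHn W'.
- rewrite -ltnS; apply: leq_trans ltWn; rewrite ltnS; apply/proper_card/properP.
  split; first exact: subsetDl.
  by have [x xc] := circuit_inhabited cP; exists x; [apply: cW | rewrite !inE xc].
- move=> y; rewrite !inE => /andP[yc yW] z yz; rewrite !inE (clW y yW) // andbT.
  apply: contra yc => /(circuit_closed cP); apply; by rewrite inE adjacent_sym -[adjacent _ _]inE.
exists (c :: cs); split=> /=; last by rewrite cP.
- case/and3P: (cP) => uc _ _; rewrite cat_uniq uc ucs andbT; apply/hasPn => y.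
  by rewrite csW !inE => /andP[].
- by move=> y; rewrite mem_cat csW !inE; have [/cW ->|] := boolP (y \in c).
Qed.

Lemma ends_in_circuit c e x : circuit c -> x \in c -> x \in ends e ->
  ends e \in [seq [set y; next c y] | y <- c].
Proof.
move=> cP xc /ends_adjacent[y]; rewrite -[adjacent x y]in_set -/(neighbours x).
rewrite (neighbours_circuit cP xc); case/and3P: cP => uc _ _.
by case/set2P=> -> ->; apply/mapP;
  [exists x | exists (prev c x); rewrite ?mem_prev // next_prev // setUC].
Qed.

Lemma cycle_system_circuits cs :
  uniq (flatten cs) -> (forall v, v \in flatten cs) -> all circuit cs -> cycle_system cs.
Proof.
move=> ucs in_cs /allP csP; split=> //; set s1 := map _ _; set s2 := map _ _.
have us1 : uniq s1 by rewrite map_inj_uniq ?enum_uniq.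
have sub12 : {subset s1 <= s2}.
  move=> z /mapP[e _ ->]; have [x xe] := edge_inhabited e.
  have /flattenP[c c_cs xc] := in_cs x; have cP := csP c c_cs.
  have /mapP[y yc ->] := ends_in_circuit cP xc xe; apply/mapP; exists (y, next c y) => //.
  apply/flattenP; exists (cycle_edges c); first exact: map_f.
  by case/and3P: cP => uc _ _; rewrite cycle_edges_next //; apply/mapP; exists y.
have le21 : size s2 <= size s1.
  rewrite [size s1]size_map -cardE handshake size_map size_cycles_edges cardE.
  by apply: uniq_leq_size => // v _; rewrite mem_enum.
apply: uniq_perm => //; first exact: leq_size_uniq us1 sub12 le21.
by case: (uniq_min_size us1 sub12 le21).
Qed.

Definition edges_within (c : seq (vert F)) : {set edge F} := [set e | ends e \subset c].

Lemma next_pair_sub (c : seq (vert F)) x : x \in c -> [set x; next c x] \subset c.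
Proof. by move=> xc; apply/subsetP => y /set2P[]->; rewrite ?mem_next. Qed.

Lemma is_cycle_circuit c : circuit c -> is_cycle (size c) (edges_within c).
Proof.
move=> cP; case/and3P: (cP) => uc c3 cc; rewrite /is_cycle (ltnW c3).
apply/existsP; exists (in_tuple c); rewrite uc; apply: uniq_perm.
- by rewrite map_inj_uniq ?enum_uniq.
- exact: uniq_next_pairs.
move=> z; apply/mapP/mapP => [[e]|[x xc ->]].
  rewrite mem_enum inE => /subsetP ec ->; have [x xe] := edge_inhabited e.
  by have /mapP[y] := ends_in_circuit cP (ec x xe) xe; exists y.
have /adjacentP[e eE] := next_cycle cc xc.
by exists e; rewrite // mem_enum inE eE next_pair_sub.
Qed.

Lemma circuit_of_is_cycle m C :
  2 < m -> is_cycle m C -> exists c, [/\ circuit c, size c = m & C = edges_within c].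
Proof.
move=> m3 /andP[_ /existsP[c /andP[uc /perm_mem cE]]].
have cP : circuit c.
  rewrite /circuit uc size_tuple m3; apply: cycle_from_next => // x xc; apply/adjacentP.
  have : [set x; next c x] \in [seq [set y; next c y] | y <- c] by apply: map_f.
  by rewrite -cE => /mapP[e _ eE]; exists e.
exists c; split; rewrite ?size_tuple //; apply/setP => e; rewrite inE.
apply/idP/idP => [eC|/subsetP ec].
  have : ends e \in [seq [set y; next c y] | y <- c].
    by rewrite -cE; apply: map_f; rewrite mem_enum.
  by case/mapP=> x xc ->; apply: next_pair_sub.
have [x xe] := edge_inhabited e.
have := ends_in_circuit cP (ec x xe) xe; rewrite -cE => /mapP[e' e'C /F_simple ->].
by rewrite mem_enum in e'C.
Qed.

Lemma nu_circuits cs m :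
  uniq (flatten cs) -> (forall v, v \in flatten cs) -> all circuit cs -> 2 < m ->
  nu m F = count_mem m (map size cs).
Proof.
move=> ucs in_cs /allP csP m3; pose cm := [seq c <- cs | size c == m].
have ucm : uniq (map edges_within cm).
  rewrite map_inj_in_uniq ?filter_uniq //.
    by apply: uniq_flatten_uniq => //; apply/negP => /csP; rewrite /circuit.
  move=> c d; rewrite !mem_filter => /andP[_ c_cs] /andP[_ d_cs] cdE.
  have [x xc] := circuit_inhabited (csP c c_cs); case/and3P: (csP c c_cs) => _ _ cc.
  have /adjacentP[e eE] := next_cycle cc xc.
  have : e \in edges_within d by rewrite -cdE inE eE next_pair_sub.
  rewrite inE eE => /subsetP/(_ x); rewrite set21 => /(_ isT) xd.
  exact: uniq_flatten_mem_eq ucs c_cs d_cs xc xd.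
rewrite count_map -size_filter -(size_map edges_within) -(card_uniqP ucm).
apply: eq_card => C; rewrite inE; apply/idP/mapP => [|[c]]; last first.
  by rewrite mem_filter => /andP[/eqP <- /csP cP] ->; apply: is_cycle_circuit.
move/(circuit_of_is_cycle m3) => [c [cP sz_c ->]]; have [x xc] := circuit_inhabited cP.
have /flattenP[d d_cs xd] := in_cs x; have cdE := eq_mem_circuit cP (csP d d_cs) xc xd.
exists d; last by apply/setP => e; rewrite !inE; apply: eq_subset_r.
case/and3P: (cP) (csP d d_cs) => uc _ _ /and3P[ud _ _].
by rewrite mem_filter d_cs -sz_c /= (perm_size (uniq_perm uc ud cdE)) eqxx.
Qed.

Lemma ex_cycle_system : exists cs : seq (seq (vert F)),
  [/\ cycle_system cs, all (fun m => 2 < m) (map size cs)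
    & forall m, 2 < m -> nu m F = count_mem m (map size cs)].
Proof.
have [|cs [ucs csT csP]] := @ex_circuits [set: vert F]; first by move=> x _ y; rewrite inE.
have in_cs v : v \in flatten cs by rewrite csT inE.
exists cs; split=> [||m m3]; first exact: cycle_system_circuits.
  by rewrite all_map; apply: sub_all csP => c /and3P[].
exact: nu_circuits.
Qed.

End TwoRegular.

(** * Tilings by 3 and by 4 differences *)

Definition absorbs_triangle (m : nat) : bool := (m == 5) || (6 < m).

Lemma tiles3 s :
  all (fun m => 2 < m) s -> count_mem 3 s <= count absorbs_triangle s -> tiles pattern3 s.
Proof.
have [n] := ubnP (size s); elim: n s => // n IHn s lt_n s_gt2 le_count.
have [s3|s3] := boolP (3 \in s); last first.
  apply: tiles_singletons => m ms; apply: tiles3_cycle.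
  by have := allP s_gt2 m ms; have : m != 3 by [apply: contraNneq s3 => <-]; lia.
have /hasP[m ms m_abs] : has absorbs_triangle s.
  by rewrite has_count; apply: leq_trans le_count; rewrite -has_count has_pred1.
have m_rem : m \in rem 3 s by apply: rem_mem => //; case: eqP m_abs => // ->.
have sE : perm_eq s ([:: m; 3] ++ rem m (rem 3 s)).
  apply/permP => a.
  by rewrite (permP (perm_to_rem s3)) /= (permP (perm_to_rem m_rem)) /= addnCA.
apply: (@tiles_trade_perm _ _ ([:: m; 3] ++ rem m (rem 3 s))); first by rewrite perm_sym.
apply: tiles_trade_cat; first exact: tiles3_triangle_cycle.
move: lt_n s_gt2 le_count; rewrite (perm_size sE) (perm_all _ sE) !(permP sE) /=.
move=> lt_n /andP[_ u_gt2]; rewrite m_abs => le_count.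
by apply: IHn => //; move: le_count; case: eqP m_abs => [->|] //=; lia.
Qed.

Lemma tiles_nseq X k n m : tiles X (nseq k m) -> tiles X (nseq (n * k) m).
Proof.
move=> tk; elim: n => [|n IHn]; first exact: tiles_nil.
by rewrite mulSn nseqD; apply: tiles_trade_cat.
Qed.

Lemma perm_lengths s : all (fun m => 2 < m) s ->
  perm_eq s (nseq (count_mem 3 s) 3 ++ nseq (count_mem 4 s) 4 ++ [seq m <- s | 4 < m]).
Proof.
move=> s_gt2; apply/permP => a; elim: s s_gt2 => //= m s IHs /andP[m_gt2 /IHs ->].
have [->|m3] := eqVneq m 3; first by rewrite !count_cat !count_nseq mulnDr; lia.
have [->|m4] := eqVneq m 4; first by rewrite !count_cat !count_nseq mulnDr; lia.
have m_gt4 : 4 < m by lia.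
by rewrite m_gt4 !add0n !count_cat /=; lia.
Qed.

Lemma mod3_cases n : [\/ n %% 3 = 0, n %% 3 = 1 | n %% 3 = 2].
Proof.
by have := ltn_pmod n (isT : 0 < 3); case: (n %% 3) => [|[|[]]] // _; constructor.
Qed.

Lemma tiles4_divisible s :
  all (fun m => 2 < m) s -> 3 %| count_mem 3 s -> 2 %| count_mem 4 s -> tiles pattern4 s.
Proof.
move=> s_gt2 /dvdnP[q3 s3E] /dvdnP[q4 s4E]; have := perm_lengths s_gt2.
rewrite perm_sym => /tiles_trade_perm; apply; rewrite s3E s4E.
apply: tiles_trade_cat; first exact: (@tiles_nseq _ 3 q3 3 tiles4_triangles).
apply: tiles_trade_cat; first exact: (@tiles_nseq _ 2 q4 4 tiles4_squares).
by apply: tiles_singletons => m; rewrite mem_filter => /andP[/tiles4_cycle].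
Qed.

Lemma tiles4_extend t r s :
  tiles_trade pattern4 t r -> all (fun m => 2 < m) s ->
  all (fun m => count_mem m r <= count_mem m s) r ->
  count_mem 3 s = count_mem 3 r %[mod 3] -> count_mem 4 s = count_mem 4 r %[mod 2] ->
  tiles_trade pattern4 t s.
Proof.
move=> tr s_gt2 /allP le_r s3 s4.
have [w w_s r_w] : exists2 w, subseq w s & perm_eq r w.
  apply/count_subseqP => m; have [/le_r //|/count_memPn->//] := boolP (m \in r).
have [u suE] := perm_to_subseq w_s.
have sE : perm_eq s (r ++ u) by apply: perm_trans suE _; rewrite perm_cat2r perm_sym.
apply: (@tiles_trade_perm _ _ (r ++ u)); first by rewrite perm_sym.
move: s_gt2 s3 s4; rewrite (perm_all _ sE) !(permP sE) all_cat !count_cat => /andP[_ u_gt2] s3 s4.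
by apply: tiles_trade_cat => //; apply: tiles4_divisible => //; lia.
Qed.

Section FourDifferences.

Variable s : seq nat.
Hypothesis s_gt2 : all (fun m => 2 < m) s.

Lemma tiles4_trade_odd_squares :
  odd (count_mem 4 s) -> 0 < count_mem 3 s -> tiles_trade pattern4 central_trade s.
Proof.
move=> /= odd4 pos3.
have /= [s3|s3|s3] := mod3_cases (count_mem 3 s).
- by apply: tiles4_extend tiles4_trade_three_triangles_square s_gt2 _ _ _ => /=; lia.
- by apply: tiles4_extend tiles4_trade_triangle_square s_gt2 _ _ _ => /=; lia.
- by apply: tiles4_extend tiles4_trade_two_triangles_square s_gt2 _ _ _ => /=; lia.
Qed.

Lemma tiles4_even_squares :
  ~~ odd (count_mem 4 s) -> 0 < count_mem 4 s -> tiles pattern4 s.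
Proof.
move=> /= even4 pos4.
have /= [s3|s3|s3] := mod3_cases (count_mem 3 s).
- by apply: tiles4_divisible => //; lia.
- by apply: tiles4_extend tiles4_triangle_squares s_gt2 _ _ _ => /=; lia.
- by apply: tiles4_extend tiles4_two_triangles_squares s_gt2 _ _ _ => /=; lia.
Qed.

Lemma tiles4_long_even (m : nat) :
  m \in s -> 4 < m -> ~~ odd (count_mem 4 s) -> tiles pattern4 s.
Proof.
rewrite -has_pred1 has_count => /= m_s m_gt4 even4.
have /= [s3|s3|s3] := mod3_cases (count_mem 3 s).
- by apply: tiles4_divisible => //; lia.
- by apply: tiles4_extend (tiles4_triangle_cycle m_gt4) s_gt2 _ _ _ => /=; lia.
- by apply: tiles4_extend (tiles4_two_triangles_cycle m_gt4) s_gt2 _ _ _ => /=; lia.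
Qed.

Lemma tiles4_long_odd (m : nat) :
  m \in s -> 4 < m -> odd (count_mem 4 s) -> count_mem 3 s = 0 ->
  tiles pattern4 s \/ tiles_trade pattern4 central_trade s.
Proof.
rewrite -has_pred1 has_count => /= m_s m_gt4 odd4 no3; have [m5|m5] := eqVneq m 5.
  rewrite m5 in m_s.
  by right; apply: tiles4_extend tiles4_trade_square_pentagon s_gt2 _ _ _ => /=; lia.
have m_gt5 : 5 < m by lia.
by left; apply: tiles4_extend (tiles4_square_cycle m_gt5) s_gt2 _ _ _ => /=; lia.
Qed.

Lemma sumn_triangles_squares :
  ~~ has (fun m => 4 < m) s -> sumn s = 3 * count_mem 3 s + 4 * count_mem 4 s.
Proof.
rewrite has_filter negbK => /eqP short.
by rewrite [LHS](perm_sumn (perm_lengths s_gt2)) short cats0 sumn_cat !sumn_nseq.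
Qed.

Lemma tiles4 :
  odd (sumn s) -> ~~ (3 %| sumn s) ->
  tiles pattern4 s \/ tiles_trade pattern4 central_trade s.
Proof.
move=> odd_s ndvd3_s; have [odd4|even4] := boolP (odd (count_mem 4 s)).
  have [no3|pos3] := posnP (count_mem 3 s); last by right; apply: tiles4_trade_odd_squares.
  have [/hasP[m m_s m_gt4]|/sumn_triangles_squares sE] := boolP (has (fun m => 4 < m) s).
    exact: tiles4_long_odd m_s m_gt4 odd4 no3.
  by rewrite sE no3 oddM in odd_s.
left; have [/hasP[m m_s m_gt4]|/sumn_triangles_squares sE] := boolP (has (fun m => 4 < m) s).
  exact: tiles4_long_even m_s m_gt4 even4.
apply: tiles4_even_squares => //; rewrite lt0n; apply: contra ndvd3_s => /eqP no4.
by rewrite sE no4 addn0 dvdn_mulr.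
Qed.

End FourDifferences.

(** * Assembling the theorem *)

Lemma sumn_size_cycle_system F (cs : seq (seq (vert F))) :
  cycle_system cs -> sumn (map size cs) = graph_order F.
Proof.
case=> ucs in_cs _; rewrite /graph_order -[LHS]size_flatten -(card_uniqP ucs).
by apply: eq_card => v; rewrite in_cs.
Qed.

Lemma sum_count_mem k n s :
  \sum_(k <= i < n) count_mem i s = count (fun m => k <= m < n) s.
Proof.
elim: s => [|m s IHs] /=; first by rewrite big1.
rewrite big_split IHs /=; congr (_ + _); rewrite -mem_index_iota.
rewrite -(count_uniq_mem _ (iota_uniq _ _)) -sum1_count [RHS]big_mkcond.
by apply: eq_bigr => i _; rewrite /= eq_sym; case: eqP.
Qed.

Lemma ex_mul3_mul4 lam : lam = 3 \/ 6 <= lam -> exists x y, lam = x * 3 + y * 4.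
Proof.
move=> lam_ok; have [lam3|lam3|lam3] := mod3_cases lam.
- by exists (lam %/ 3), 0; lia.
- by exists ((lam - 4) %/ 3), 1; lia.
- by exists ((lam - 8) %/ 3), 2; lia.
Qed.

Lemma has_decomposition_triangle F (cs : seq (seq (vert F))) :
  cycle_system cs -> map size cs = [:: 3] -> has_decomposition F 'I_3 1.
Proof.
move=> csP szE; pose triangle : seq 'I_3 := [:: ord0; inord 1; inord 2].
apply: (has_decomposition_cycles (ds := fun _ : unit => [:: triangle]) csP) => [_|_|a b ab].
- by rewrite szE.
- by rewrite /= !inE -!(inj_eq val_inj) /= !inordK.
rewrite (big_pred1 tt) => [/=|[]//]; rewrite !joinsE // -!(inj_eq val_inj) /= !inordK //.
by move: ab; rewrite -(inj_eq val_inj); case: a b => [[|[|[|a]]] ?] [[|[|[|b]]] ?].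
Qed.

Lemma has_factorisation_of_Fp_decomposition p F lam :
  prime p -> graph_order F = p -> has_decomposition F 'F_p lam ->
  has_factorisation (complete_mgraph lam p) F.
Proof.
move=> p_prime F_order dec; apply: has_factorisation_of_decomposition => //.
apply: (has_decomposition_bij (phi := cast_ord (Fp_cast p_prime))) dec.
by exists (cast_ord (esym (Fp_cast p_prime))); [exact: cast_ordK | exact: cast_ordKV].
Qed.

Lemma has_factorisation_order3 F lam :
  simple_graph F -> regular_graph 2 F -> graph_order F = 3 ->
  has_factorisation (complete_mgraph lam 3) F.
Proof.
move=> F_simple F_regular F_order.
have [cs [csP + _]] := ex_cycle_system F_simple F_regular.
have := sumn_size_cycle_system csP; rewrite F_order => sz_cs gt2_cs.
apply: has_factorisation_of_decomposition => //; rewrite -[lam]muln1.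
apply/has_decompositionM/(has_decomposition_triangle csP).
case: (map size cs) sz_cs gt2_cs => [|m [|m' s]] //=; first by rewrite addn0 => ->.
by move=> sz_cs /and3P[m_gt2 m'_gt2 _]; lia.
Qed.

Section Decompositions.

Variables (p : nat) (F : mgraph).
Hypotheses (p_prime : prime p) (p_odd : odd p) (p_neq3 : p != 3).
Hypotheses (F_simple : simple_graph F) (F_regular : regular_graph 2 F).
Hypothesis F_order : graph_order F = p.

Lemma ndvd_small_differences D : all (fun d => 0 < d < 5) D -> all (fun d => ~~ (p %| d)) D.
Proof.
have p_gt4 : 4 < p by move: p_prime p_odd p_neq3; case: p => [|[|[|[|[|]]]]].
by apply: sub_all => d /andP[d_gt0 d_lt5]; rewrite gtnNdvd //; lia.
Qed.

Lemma has_decomposition4 : has_decomposition F 'F_p 4.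
Proof.
have [cs [csP gt2_cs _]] := ex_cycle_system F_simple F_regular.
have sz_cs := sumn_size_cycle_system csP; rewrite F_order in sz_cs.
have ndvd := @ndvd_small_differences (differences pattern4) isT.
have [||tile|tile] := tiles4 gt2_cs; rewrite ?sz_cs //.
- by rewrite dvdn_prime2 // eq_sym.
- exact: has_decomposition_tiles csP sz_cs ndvd (@neutral_no_trade p) tile.
- exact: has_decomposition_tiles csP sz_cs ndvd (neutral_central_trade p_prime p_odd) tile.
Qed.

Lemma has_decomposition3 :
  nu 3 F <= nu 5 F + \sum_(7 <= i < p.+1) nu i F -> has_decomposition F 'F_p 3.
Proof.
have [cs [csP gt2_cs nuE]] := ex_cycle_system F_simple F_regular.
have sz_cs := sumn_size_cycle_system csP; rewrite F_order in sz_cs.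
have ndvd := @ndvd_small_differences (differences pattern3) isT.
rewrite !nuE // (eq_big_nat _ _ (F2 := fun i => count_mem i (map size cs))); last first.
  by move=> i /andP[i_gt6 _]; apply: nuE; lia.
rewrite sum_count_mem => le_count.
apply: has_decomposition_tiles csP sz_cs ndvd (@neutral_no_trade p) (tiles3 gt2_cs _) => //.
apply: leq_trans le_count _; rewrite -count_predUI.
rewrite [X in _ + X](eq_count (a2 := pred0)) ?count_pred0 ?addn0 => [|m /=]; last by lia.
by apply: sub_count => m /=; rewrite /absorbs_triangle; lia.
Qed.

End Decompositions.

Theorem theorem33 (p : nat) (F : mgraph) :
  prime p -> odd p ->
  simple_graph F -> regular_graph 2 F -> graph_order F = p ->
  (forall lam : nat, 1 <= lam -> lam = 0 %[mod 4] ->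
     has_factorisation (complete_mgraph lam p) F) /\
  (nu 3 F <= nu 5 F + \sum_(7 <= i < p.+1) nu i F ->
     forall lam : nat, lam = 3 \/ 6 <= lam ->
       has_factorisation (complete_mgraph lam p) F).
Proof.
move=> p_prime p_odd F_simple F_regular F_order.
have [p3|p_neq3] := eqVneq p 3.
  by rewrite p3 in F_order *; split=> *; apply: has_factorisation_order3.
have dec4 := has_decomposition4 p_prime p_odd p_neq3 F_simple F_regular F_order.
split=> [lam _ lam4|nu_le lam lam_ok]; apply: has_factorisation_of_Fp_decomposition => //.
  have -> : lam = lam %/ 4 * 4 by lia.
  exact: has_decompositionM.
have dec3 := has_decomposition3 p_prime p_odd p_neq3 F_simple F_regular F_order nu_le.
have [x [y ->]] := ex_mul3_mul4 lam_ok.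
by apply: has_decompositionD; apply: has_decompositionM.
Qed.
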